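(* Let $x \in C$ and $A \in \mathbb{R}$. If $v(\sigma x - x) \geq A$ for all $\sigma \in G$, then for every $m \in \mathbb{N}$ there exists $y_m \in K_m$ such that $v(x - y_m) \geq A - \frac{1}{p^m(p-1)}$. Conversely, if for every $m \in \mathbb{N}$ there exists $y_m \in K_m$ such that $v(x-y_m) \geq A - \frac{1}{p^m(p-1)}$, then $v(\sigma x - x) \geq A$ for all $\sigma \in G$.
   Context: Let $p$ be a prime number, $k$ a perfect field of characteristic $p$, $F = \mathrm{Frac}\, W(k)$ the fraction field of the ring of Witt vectors of $k$, and $K$ a finite totally ramified extension of $F$. Let $\pi$ be a uniformizer of $K$. Let $\bar{K}$ be an algebraic closure of $K$ and $C$ the completion of $\bar{K}$ for the valuation $v$ extending that of $F$, normalized by $v(p)=1$ (with $v(0)=+\infty$); $v$ is extended to $C$. Let $G = \mathrm{Gal}(\bar{K}/K)$, acting on $C$ by continuity. Fix $\pi_0 = \pi$ and elements $\pi_m \in \bar{K}$ with $\pi_{m+1}^p = \pi_m$ for all $m \geq 0$, and put $K_m = K(\pi_m)$. Here $\mathbb{N} = \{0,1,2,\dots\}$. *)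

(* Defs.v *)
From HB Require Import structures.
From mathcomp Require Import all_boot all_order all_algebra all_field.
From mathcomp Require Import reals constructive_ereal.
(* The notations of mpoly clash with those of reals. *)
From mathcomp Require Import -(notations) mpoly.

Set Implicit Arguments.
Unset Strict Implicit.
Unset Printing Implicit Defensive.

Import Order.TTheory GRing.Theory Num.Theory.
Local Open Scope ring_scope.

Definition perfect_char (p : nat) (k : fieldType) : Prop :=
  p \in [pchar k] /\ forall a : k, exists b : k, b ^+ p = a.

(* The n-th ghost component
     w_n(x) = x_0^(p^n) + p x_1^(p^(n-1)) + ... + p^n x_n. *)
Definition ghost (p : nat) (S : comNzRingType) (x : nat -> S) (n : nat) : S :=
  \sum_(i < n.+1) (p ^ i)%:R * x i ^+ (p ^ (n - i)).

(* Integral polynomials in X_0, ..., X_N, Y_0, ..., Y_N; the variables X_i and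
   Y_i are only used for i <= N (inord is meaningless beyond). *)
Definition wittPoly (N : nat) : comNzRingType :=
  mpoly (N.+1 + N.+1) int.

Definition wittX (N i : nat) : wittPoly N :=
  mpolyX int (mnm1 (lshift N.+1 (inord i : 'I_N.+1))).

Definition wittY (N i : nat) : wittPoly N :=
  mpolyX int (mnm1 (rshift N.+1 (inord i : 'I_N.+1))).

(* Evaluation of the image of P in k[X_0, ..., Y_N] at X_i = a i, Y_i = b i. *)
Definition wittEval (k : comNzRingType) (N : nat) (P : wittPoly N)
    (a b : nat -> k) : k :=
  meval (fun i => match split i with inl j => a j | inr j => b j end)
    (map_mpoly intr P).

(* W is the ring W(k) of p-typical Witt vectors of k, the element w being the
   vector (c w 0, c w 1, ...): its addition and multiplication are given by the
   universal integral polynomials S_n, P_n (unique, Z[X, Y] being torsion-free)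
   such that w_n(S) = w_n(X) + w_n(Y) and w_n(P) = w_n(X) w_n(Y).  The bound N
   only serves to have finitely many variables. *)
Definition is_Witt_ring (p : nat) (k : comNzRingType) (W : comNzRingType)
    (c : W -> nat -> k) : Prop :=
  bijective c /\
  forall N : nat, exists S P : nat -> wittPoly N,
    forall n : nat, (n <= N)%N ->
      [/\ ghost p S n = ghost p (@wittX N) n + ghost p (@wittY N) n,
          ghost p P n = ghost p (@wittX N) n * ghost p (@wittY N) n,
          forall a b : W, c (a + b) n = wittEval (S n) (c a) (c b)
        & forall a b : W, c (a * b) n = wittEval (P n) (c a) (c b)].

Section Valuations.
Variable R : realType.
Local Open Scope ereal_scope.

Definition is_valuation (L : fieldType) (v : L -> \bar R) : Prop :=
  [/\ forall x, v x != -oo,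
      forall x, v x = +oo <-> x = 0%R,
      forall x y, v (x * y)%R = v x + v y
    & forall x y, Order.min (v x) (v y) <= v (x + y)%R].

Definition is_uniformizer (L : fieldType) (v : L -> \bar R) (t : L) : Prop :=
  [/\ 0 < v t, t != 0%R & forall a : L, 0 < v a -> v t <= v a].

(* v is the valuation of Frac W normalized by v p = 1, for W = W(k): on W, it
   is the exact exponent of p. *)
Definition is_padic_valuation (p : nat) (W : idomainType)
    (v : {fraction W} -> \bar R) : Prop :=
  is_valuation v /\
  forall (w : W) (n : nat),
    v (@tofrac W w) = n%:R%:E <->
    (exists u : W, w = p%:R ^+ n * u)%R /\
    ~ (exists u : W, w = p%:R ^+ n.+1 * u)%R.

(* The ramification index e, given by v (t_F) = e * v (t_K) for uniformizers
   t_F of F and t_K of K, equals [K : F]; the valuation of F is the restriction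
   of v. *)
Definition totally_ramified (F : fieldType) (K : fieldExtType F)
    (v : K -> \bar R) : Prop :=
  exists (tF : F) (tK : K),
    [/\ is_uniformizer (fun a : F => v (in_alg K a)) tF,
        is_uniformizer v tK
      & v (in_alg K tF) = (\dim {:K})%:R%:E * v tK].

Definition v_converges (L : fieldType) (v : L -> \bar R) (u : nat -> L) (l : L)
    : Prop :=
  forall B : R, exists N : nat, forall n, (N <= n)%N -> B%:E <= v (u n - l)%R.

Definition v_cauchy (L : fieldType) (v : L -> \bar R) (u : nat -> L) : Prop :=
  forall B : R, exists N : nat, forall m n, (N <= m)%N -> (N <= n)%N ->
    B%:E <= v (u m - u n)%R.

Definition v_continuous (L : fieldType) (v : L -> \bar R) (f : L -> L) : Prop :=
  forall (x : L) (B : R), exists D : R, forall y : L,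
    D%:E <= v (y - x)%R -> B%:E <= v (f y - f x)%R.

(* (C, v), with the embedding j, is the completion of L for v \o j. *)
Definition is_completion (L C : fieldType) (v : C -> \bar R)
    (j : {rmorphism L -> C}) : Prop :=
  [/\ is_valuation v,
      forall u : nat -> C, v_cauchy v u -> exists l : C, v_converges v u l
    & forall (x : C) (B : R), exists z : L, B%:E <= v (x - j z)%R].

(* s is the action on C of the automorphism g of L: its extension by
   continuity. *)
Definition extends_by_continuity (L C : fieldType) (v : C -> \bar R)
    (j : {rmorphism L -> C}) (g : L -> L) (s : C -> C) : Prop :=
  v_continuous v s /\ forall z : L, s (j z) = j (g z).

End Valuations.

Definition is_algebraic_closure (K : fieldType) (L : closedFieldType)
    (i : {rmorphism K -> L}) : Prop :=
  forall z : L, algebraicOver i z.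

Definition in_Gal (K L : fieldType) (i : {rmorphism K -> L})
    (g : {rmorphism L -> L}) : Prop :=
  bijective g /\ forall a : K, g (i a) = i a.

(* y lies in the subfield K(z) of L. *)
Definition in_adjoin (K L : fieldType) (i : {rmorphism K -> L}) (z y : L)
    : Prop :=
  exists P Q : {poly K},
    (map_poly i Q).[z] != 0 /\ y = (map_poly i P).[z] / (map_poly i Q).[z].

(* Main.v *)
Require Import Defs.
From HB Require Import structures.
From mathcomp Require Import all_boot all_order all_algebra all_field.
From mathcomp Require Import boolp classical_sets reals constructive_ereal.
From mathcomp Require Import generic_quotient.
From mathcomp Require Import -(notations) mpoly.
From mathcomp Require Import ring lra zify.

(** Write F = Frac W, phi : F -> Kbar for the embedding, w = v o j for the
    valuation of Kbar, e = [K : F], E_m = [K_m : F] = e p^m, and c_m = 1/(p^m (p-1)), which is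
    the valuation of zeta - 1 for a root of unity zeta of order p^(m+1)
    ([vr_prim_root]).

    The elements of K_m are the sums of terms phi(f_n) pi_m^n with f_n in F and
    n < E_m.  As w(F) = Z and w(pi_m) = 1/E_m, the terms have valuations that are
    different modulo 1, so the valuation of the sum is the least of theirs
    ([vge_sum_distinct], [vge_expansion]).  An automorphism s over K is an
    isometry ([galois_isometry]) and multiplies pi_m by a root of unity of order
    dividing p^m.

    From the approximations to the invariance: if y_m approximates x up to
    A - c_m, then d = y_(m+1) - y_m has valuation at least A - c_m, and s
    multiplies the terms of d by p^(m+1)-th roots of unity, so that s d - d has
    valuation at least A ([root_unity_action]).  By induction s y_m - y_m has
    valuation at least A for every m, hence s x - x has valuation at least
    A - c_m for every m ([vge_limit]).

    From the invariance to the approximations: replace x by some z in Kbar with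
    v(x - z) >= A.  The union M of the K_m is deeply ramified: every integral
    element is a p-th power modulo p, because k is perfect and pi_m is the p-th
    power of pi_(m+1) ([frob_Kinf]).  Therefore M contains elements y with
    v(z - y) >= A - eps for every eps > 0 ([approximation]; the reason is
    explained at [improve]).  Let y lie in K_N with N > m and let s multiply pi_N
    by a primitive root of unity zeta of order p^N.  In
      s y - y = sum_n phi(f_n) pi_N^n (zeta^n - 1)
    the nonzero terms again have different valuations ([twisted_distinct]), so
    each of them has valuation at least A - eps.  If pi_N^n is not a power of
    pi_m, then zeta^n - 1 has valuation at most c_m, so dropping these terms from
    y gives y' in K_m with v(y - y') >= A - eps - c_m ([descend]).  Finally eps
    can be taken to be 0 because K_m has a discrete valuation
    ([best_approximation]).

    Three facts on local fields lie underneath.  W is a complete discrete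
    valuation ring with uniformizer p, in which every element is a p-th power
    modulo p; this rests on the formula for the Witt coordinates of p a
    ([witt_pmul]).  The valuation of a complete field extends in only one way to
    an algebraic extension ([unique_extension]), which makes the automorphisms
    over K isometries.  And the roots of a minimal polynomial are conjugate
    under automorphisms of the algebraic closure ([conjugate_automorphism]),
    which provides the automorphisms used above. *)

Set Implicit Arguments.
Unset Strict Implicit.
Unset Printing Implicit Defensive.

Import Order.TTheory GRing.Theory Num.Theory.
Local Open Scope ring_scope.

(** * Valuations *)

Lemma exprD_ends (A : comNzRingType) (x y : A) n : (0 < n)%N ->
  (x + y) ^+ n = x ^+ n + \sum_(i < n.-1) x ^+ (n - i.+1) * y ^+ i.+1 *+ 'C(n, i.+1)
    + y ^+ n.
Proof.
case: n => // n _; rewrite exprDn big_ord_recr big_ord_recl /=.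
by rewrite bin0 binn subn0 subnn !mulr1n !expr0 mulr1 mul1r.
Qed.

Section ValuationTheory.
Variables (R : realType) (L : fieldType) (v : L -> \bar R).

Definition vge (r : R) (x : L) : Prop := (r%:E <= v x)%E.

(** The valuation of a nonzero element, as a real number; 0 is a default value at 0. *)
Definition vr (x : L) : R := fine (v x).

Hypothesis hv : is_valuation v.

Lemma vge0 r : vge r 0.
Proof. by rewrite /vge; case: hv => _ /(_ 0) [_ ->] //; rewrite leey. Qed.

Lemma v_vr x : x != 0 -> v x = (vr x)%:E.
Proof.
case: hv => vNy v0 _ _ /eqP nz; rewrite /vr.
by case E: (v x) (vNy x) => [r||] // _; case: nz; apply/v0.
Qed.

Lemma vgeE r x : x != 0 -> vge r x <-> r <= vr x.
Proof. by move=> nz; rewrite /vge v_vr // lee_fin. Qed.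

Lemma vge_vr x : vge (vr x) x.
Proof.
have [->|nz] := eqVneq x 0; first exact: vge0.
by apply/vgeE.
Qed.

Lemma vgeW r s x : s <= r -> vge r x -> vge s x.
Proof. by move=> sr; apply: le_trans; rewrite lee_fin. Qed.

Lemma vgeD r x y : vge r x -> vge r y -> vge r (x + y).
Proof.
case: hv => _ _ _ vD hx hy; apply: le_trans (vD x y).
by rewrite le_min hx.
Qed.

Lemma vgeM r s x y : vge r x -> vge s y -> vge (r + s) (x * y).
Proof. by case: hv => _ _ vM _ hx hy; rewrite /vge vM EFinD leeD. Qed.

Lemma vrM x y : x != 0 -> y != 0 -> vr (x * y) = vr x + vr y.
Proof.
move=> nx ny; case: hv => _ _ vM _.
by rewrite /vr vM (v_vr nx) (v_vr ny).
Qed.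

Lemma vr1 : vr 1 = 0.
Proof.
have := vrM (oner_neq0 L) (oner_neq0 L); rewrite mulr1 => h.
by apply: (addrI (vr 1)); rewrite addr0 -h.
Qed.

Lemma vrX x n : x != 0 -> vr (x ^+ n) = vr x *+ n.
Proof.
move=> nx; elim: n => [|n IH]; first by rewrite expr0 vr1.
by rewrite exprS vrM ?expf_neq0 // IH mulrS.
Qed.

Lemma vrN x : vr (- x) = vr x.
Proof.
have nm : (-1 : L) != 0 by rewrite oppr_eq0 oner_neq0.
have h : vr (-1) = 0.
  have := vrM nm nm; rewrite mulrNN mulr1 vr1 => h; lra.
have [->|nx] := eqVneq x 0; first by rewrite oppr0.
by rewrite -mulN1r vrM // h add0r.
Qed.

Lemma vrV x : x != 0 -> vr x^-1 = - vr x.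
Proof.
move=> nx; have := vrM nx (invr_neq0 nx); rewrite divff // vr1 => h; lra.
Qed.

Lemma vgeN r x : vge r (- x) <-> vge r x.
Proof.
have [->|nx] := eqVneq x 0; first by rewrite oppr0.
by rewrite !vgeE ?oppr_eq0 // vrN.
Qed.

Lemma vgeB r x y : vge r x -> vge r y -> vge r (x - y).
Proof. by move=> hx hy; apply: vgeD => //; apply/vgeN. Qed.

Lemma vgeC r x y : vge r (x - y) -> vge r (y - x).
Proof. by move=> h; rewrite -opprB; apply/vgeN. Qed.

Lemma vge_trans r y x z : vge r (x - y) -> vge r (y - z) -> vge r (x - z).
Proof. by move=> h1 h2; have := vgeD h1 h2; rewrite addrA subrK. Qed.

Lemma vge_sum r (I : Type) (s : seq I) (P : pred I) (f : I -> L) :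
  (forall i, P i -> vge r (f i)) -> vge r (\sum_(i <- s | P i) f i).
Proof. by move=> h; elim/big_ind: _ => //; [exact: vge0|exact: vgeD]. Qed.

Lemma vge1 : vge 0 1.
Proof. by apply/vgeE; rewrite ?oner_neq0 // vr1. Qed.

Lemma vgeX r x n : vge r x -> vge (r *+ n) (x ^+ n).
Proof.
move=> h; elim: n => [|n IH]; first exact: vge1.
by rewrite exprS mulrS; apply: vgeM.
Qed.

Lemma vgeX0 x n : vge 0 x -> vge 0 (x ^+ n).
Proof. by move=> /(@vgeX _ _ n); rewrite mul0rn. Qed.

Lemma vgeMl r x y : vge 0 x -> vge r y -> vge r (x * y).
Proof. by move=> hx hy; have := vgeM hx hy; rewrite add0r. Qed.

Lemma vgeMr r x y : vge r x -> vge 0 y -> vge r (x * y).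
Proof. by move=> hx hy; have := vgeM hx hy; rewrite addr0. Qed.

Lemma vge_nat n : vge 0 n%:R.
Proof.
elim: n => [|n IH]; first exact: vge0.
by rewrite -addn1 natrD; apply: vgeD => //; exact: vge1.
Qed.

Lemma vgeMI r x y : y != 0 -> vge (r + vr y) (x * y) -> vge r x.
Proof.
move=> ny; have [->|nx] := eqVneq x 0; first by move=> _; exact: vge0.
by rewrite !vgeE ?mulf_neq0 // vrM // lerD2r.
Qed.

Lemma vge_root r x n : (0 < n)%N -> vge r (x ^+ n) -> vge (r / n%:R) x.
Proof.
move=> n0; have [->|nx] := eqVneq x 0; first by move=> _; exact: vge0.
by rewrite !vgeE ?expf_neq0 // vrX // ler_pdivrMr ?ltr0n // mulr_natr.
Qed.

Lemma vge_eq0 x : (forall n : nat, vge n%:R x) -> x = 0.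
Proof.
move=> h; apply/eqP/negPn/negP => nx.
have /(vgeE _ nx) := h (Num.bound `|vr x|).
by rewrite leNgt (le_lt_trans (ler_norm _) (archi_boundP (normr_ge0 _))).
Qed.

Lemma vr_gap r x y : x != 0 -> vge r y -> vr x < r ->
  x + y != 0 /\ vr (x + y) = vr x.
Proof.
move=> nx hy lt.
have nz : x + y != 0.
  apply/eqP => /addr0_eq e; move: hy; rewrite -e => /vgeN/vgeE => /(_ nx).
  by rewrite leNgt lt.
split=> //; apply/eqP; rewrite eq_le; apply/andP; split; last first.
  by apply/(vgeE _ nz); apply: vgeD; [exact: vge_vr|apply: vgeW hy; exact: ltW].
rewrite leNgt; apply/negP => h.
have : vge (Num.min r (vr (x + y))) x.
  rewrite -[X in vge _ X](addrK y x); apply: vgeB.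
    by apply: vgeW (vge_vr _); rewrite ge_min lexx orbT.
  by apply: vgeW hy; rewrite ge_min lexx.
by move/(vgeE _ nx); rewrite leNgt lt_min lt h.
Qed.

(** The term of least valuation dominates the sum of the others, by [vr_gap]. *)
Lemma vr_sum_distinct (I : finType) (t : I -> L) :
  (forall i k, i != k -> t i != 0 -> t k != 0 -> vr (t i) != vr (t k)) ->
  (forall i, t i = 0) \/
  exists i, [/\ t i != 0, \sum_k t k != 0, vr (\sum_k t k) = vr (t i)
              & forall k, t k != 0 -> vr (t i) <= vr (t k)].
Proof.
move=> dist; case: (pickP (fun i => t i != 0)) => [i0 nz0|al]; last first.
  by left=> i; apply/eqP; have /negbT := al i; rewrite negbK.
right; case: (arg_minP (fun i => vr (t i)) (P := fun i => t i != 0) nz0) => i ni imin.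
pose rest := \sum_(k | k != i) t k.
have [r ltr hr] : exists2 r, vr (t i) < r & vge r rest.
  rewrite /rest; elim/big_ind: _ => [|x y [r1 l1 h1] [r2 l2 h2]|k nk].
  - by exists (vr (t i) + 1); [rewrite ltrDl|exact: vge0].
  - exists (Num.min r1 r2); first by rewrite lt_min l1.
    by apply: vgeD; [apply: vgeW h1|apply: vgeW h2]; rewrite ge_min lexx ?orbT.
  have [->|nz] := eqVneq (t k) 0.
    by exists (vr (t i) + 1); [rewrite ltrDl|exact: vge0].
  exists (vr (t k)); last exact: vge_vr.
  by rewrite lt_neqAle imin // andbT; apply: dist; rewrite // eq_sym.
have [nS eS] := vr_gap ni hr ltr.
exists i; have -> : \sum_k t k = t i + rest by rewrite (bigD1 i).
by split.
Qed.

Lemma vge_sum_distinct (I : finType) (t : I -> L) r :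
  (forall i k, i != k -> t i != 0 -> t k != 0 -> vr (t i) != vr (t k)) ->
  vge r (\sum_k t k) -> forall i, vge r (t i).
Proof.
move=> /vr_sum_distinct [h _ i|[i [ni nS eS imin]]]; first by rewrite h; exact: vge0.
move=> /(vgeE _ nS); rewrite eS => le k.
have [->|nk] := eqVneq (t k) 0; first exact: vge0.
by apply/vgeE => //; apply: le_trans (imin k nk).
Qed.

(** * Frobenius modulo p *)
Variable p : nat.
Hypotheses (p_pr : prime p) (vp : vge 1 p%:R).

Lemma vge_dvdn n : (p %| n)%N -> vge 1 n%:R.
Proof.
by case/dvdnP=> m ->; rewrite natrM; apply: vgeMl => //; exact: vge_nat.
Qed.

Lemma vge_frobD x y : vge 0 x -> vge 0 y ->
  vge 1 ((x + y) ^+ p - (x ^+ p + y ^+ p)).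
Proof.
move=> hx hy; rewrite exprD_ends ?prime_gt0 //; set S := \sum_(i < _) _.
have -> : x ^+ p + S + y ^+ p - (x ^+ p + y ^+ p) = S by ring.
apply: vge_sum => i _; rewrite -mulr_natr; apply: vgeMl.
  by apply: vgeMl; apply: vgeX0.
by apply/vge_dvdn/prime_dvd_bin => //; rewrite /= -ltn_predRL.
Qed.

Lemma vge_congX r x y n : vge 0 x -> vge 0 y -> vge r (x - y) ->
  vge r (x ^+ n - y ^+ n).
Proof.
move=> hx hy h; rewrite subrXX; apply: vgeMr => //.
by apply: vge_sum => i _; apply: vgeMl; apply: vgeX0.
Qed.

Lemma vge_frobDX x y a : vge 0 x -> vge 0 y ->
  vge 1 ((x + y) ^+ (p ^ a) - (x ^+ (p ^ a) + y ^+ (p ^ a))).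
Proof.
move=> hx hy; elim: a => [|a IH]; first by rewrite expn0 !expr1 subrr; exact: vge0.
rewrite expnSr !exprM.
apply: (@vge_trans _ ((x ^+ (p ^ a) + y ^+ (p ^ a)) ^+ p)).
  by apply: vge_congX => //; rewrite ?exprD; do ?[apply: vgeX0|apply: vgeD].
by apply: vge_frobD; apply: vgeX0.
Qed.

Lemma vge_frob_sum (I : Type) (s : seq I) (f : I -> L) :
  (forall i, vge 0 (f i)) ->
  vge 1 ((\sum_(i <- s) f i) ^+ p - \sum_(i <- s) f i ^+ p).
Proof.
move=> h; elim: s => [|i s IH].
  by rewrite !big_nil expr0n (gtn_eqF (prime_gt0 p_pr)) subrr; exact: vge0.
rewrite !big_cons.
apply: (@vge_trans _ (f i ^+ p + (\sum_(k <- s) f k) ^+ p)).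
  by apply: vge_frobD => //; apply: vge_sum.
by rewrite opprD addrACA subrr add0r.
Qed.

End ValuationTheory.

(** * Witt polynomials and ghost components *)

Section WittPolynomials.
Variables (p N : nat).

(** [wittEval] as a ring homomorphism. *)
Definition wittHom (A : comNzRingType) (a b : nat -> A) : wittPoly N -> A :=
  (meval (fun i => match split i with inl j => a j | inr j => b j end))
  \o (map_mpoly intr).

HB.instance Definition _ A a b := GRing.RMorphism.on (@wittHom A a b).

Lemma wittEvalE (A : comNzRingType) (P : wittPoly N) (a b : nat -> A) :
  wittEval P a b = wittHom a b P.
Proof. by []. Qed.

Lemma wittHomX (A : comNzRingType) (a b : nat -> A) i : (i <= N)%N ->
  wittHom a b (wittX N i) = a i.
Proof.
move=> le; rewrite /wittHom /wittX /= map_mpolyX mevalXU.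
case: splitP => j /= e; first by rewrite -e inordK.
by have := ltn_ord (inord i : 'I_N.+1); rewrite e ltnNge leq_addr.
Qed.

Lemma wittHomY (A : comNzRingType) (a b : nat -> A) i : (i <= N)%N ->
  wittHom a b (wittY N i) = b i.
Proof.
move=> le; rewrite /wittHom /wittY /= map_mpolyX mevalXU.
case: splitP => j /= e.
  by have := ltn_ord j; rewrite -e ltnNge leq_addr.
by move/addnI: e => <-; rewrite inordK.
Qed.

Lemma rmorph_ghost (A B : comNzRingType) (f : {rmorphism A -> B}) x n :
  f (ghost p x n) = ghost p (f \o x) n.
Proof.
rewrite /ghost rmorph_sum; apply: eq_bigr => i _.
by rewrite rmorphM rmorphXn rmorph_nat.
Qed.

Lemma eq_ghost (A : comNzRingType) (x y : nat -> A) n :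
  (forall i, (i <= n)%N -> x i = y i) -> ghost p x n = ghost p y n.
Proof. by move=> e; apply: eq_bigr => i _; rewrite e // -ltnS. Qed.

Lemma eq_wittEval (A : comNzRingType) (P : wittPoly N) (a b a' b' : nat -> A) :
  (forall i, (i <= N)%N -> a i = a' i) -> (forall i, (i <= N)%N -> b i = b' i) ->
  wittEval P a b = wittEval P a' b'.
Proof.
move=> ea eb; apply: meval_eq => i.
by case: splitP => j _; [apply: ea|apply: eb]; rewrite -ltnS.
Qed.

Lemma rmorph_wittEval (A B : comNzRingType) (f : {rmorphism A -> B}) P a b :
  f (wittEval P a b) = wittEval (N := N) P (f \o a) (f \o b).
Proof.
rewrite !wittEvalE; elim/mpolyind: P => [|c m P _ _ IH]; first by rewrite !rmorph0.
rewrite !rmorphD IH; congr (_ + _).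
have eZ (D : comNzRingType) (x y : nat -> D) : wittHom x y (c *: mpolyX int m) = c%:~R *
    \prod_(i < N.+1 + N.+1) (match split i with inl j => x j | inr j => y j end) ^+ m i.
  by rewrite /wittHom /= map_mpolyZ map_mpolyX mevalZ mevalX.
rewrite /= !eZ rmorphM rmorph_int rmorph_prod; congr (_ * _); apply: eq_bigr => i _.
by rewrite rmorphXn; case: (split i).
Qed.

Lemma wittEval_ghostD (S : nat -> wittPoly N) m : (m <= N)%N ->
  ghost p S m = ghost p (@wittX N) m + ghost p (@wittY N) m ->
  forall (A : comNzRingType) (a b : nat -> A),
  ghost p (fun i => wittEval (S i) a b) m = ghost p a m + ghost p b m.
Proof.
move=> lem eS A a b; pose f : {rmorphism wittPoly N -> A} := wittHom a b.
transitivity (f (ghost p S m)).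
  by apply/esym; etransitivity; [exact: rmorph_ghost|exact: eq_ghost].
transitivity (f (ghost p (@wittX N) m) + f (ghost p (@wittY N) m)).
  by rewrite -rmorphD; apply: (congr1 f eS).
congr (_ + _); (etransitivity; first exact: rmorph_ghost).
  by apply: eq_ghost => i lei; apply: wittHomX; apply: leq_trans lem.
by apply: eq_ghost => i lei; apply: wittHomY; apply: leq_trans lem.
Qed.

(** Both sides consist of the terms p^(i+1) x_i^(p^(m-i)), for i <= m. *)
Lemma ghost_shift_frob (A : comNzRingType) (x : nat -> A) m : (0 < p)%N ->
  p%:R * ghost p x m =
  ghost p (fun i => if i is i'.+1 then x i' ^+ p else 0) m + (p ^ m.+1)%:R * x m.
Proof.
move=> p0; rewrite /ghost [in LHS]big_ord_recr [in RHS]big_ord_recl /=.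
rewrite subnn expn0 expr1 expr0n expn_eq0 (gtn_eqF p0) /= mulr0 add0r mulrDr.
rewrite mulrA -natrM -expnS; congr (_ + _); rewrite mulr_sumr.
apply: eq_bigr => i _; rewrite /bump /= add1n -exprM -expnS mulrA -natrM -expnS.
by rewrite subnSK.
Qed.

End WittPolynomials.

(** * Dwork's congruences *)

Section Dwork.
Variables (p : nat) (A : comNzRingType).
Hypothesis p_pr : prime p.

Definition cong (n : nat) (x y : A) : Prop := exists u, x = y + (p ^ n)%:R * u.

Lemma cong0 n x : cong n x x.
Proof. by exists 0; rewrite mulr0 addr0. Qed.

Lemma congD n x y x' y' : cong n x y -> cong n x' y' -> cong n (x + x') (y + y').
Proof. by case=> u -> [u' ->]; exists (u + u'); ring. Qed.

Lemma cong_sum n (I : Type) (s : seq I) (x y : I -> A) :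
  (forall i, cong n (x i) (y i)) -> cong n (\sum_(i <- s) x i) (\sum_(i <- s) y i).
Proof.
move=> h; elim: s => [|i s IH]; first by rewrite !big_nil; exact: cong0.
by rewrite !big_cons; apply: congD.
Qed.

Lemma cong_pM n k x y : cong n x y -> cong (k + n) ((p ^ k)%:R * x) ((p ^ k)%:R * y).
Proof. by case=> u ->; exists u; rewrite expnD natrM; ring. Qed.

Lemma cong_exp n x y : (0 < n)%N -> cong n x y -> cong n.+1 (x ^+ p) (y ^+ p).
Proof.
move=> n0 [u ->]; set t := (p ^ n)%:R * u.
rewrite exprD_ends ?prime_gt0 // -[X in cong _ _ X]addr0 -[X in cong _ _ X]addr0.
apply: congD; first apply: congD; first exact: cong0.
  have e0 : \sum_(i < p.-1) (0 : A) = 0 by rewrite big1.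
  rewrite -[X in cong _ _ X]e0; apply: cong_sum => i.
  have /dvdnP [m ->] : (p %| 'C(p, i.+1))%N.
    by apply: prime_dvd_bin => //; rewrite /= -ltn_predRL.
  exists (y ^+ (p - i.+1) * t ^+ i * u * m%:R).
  by rewrite add0r expnS !natrM -mulr_natr natrM exprS /t; ring.
exists ((p ^ n)%:R ^+ p.-2 * (p ^ n.-1)%:R * u ^+ p).
have e2 : (p ^ n)%:R * (p ^ n)%:R = (p ^ n.+1)%:R * (p ^ n.-1)%:R :> A.
  by rewrite -!natrM -!expnD addSnnS prednK.
have e3 (z : A) : z ^+ p = z ^+ p.-2 * (z * z).
  by rewrite -expr2 -exprD addn2; case: (p) (prime_gt1 p_pr) => [|[|]].
by rewrite add0r /t exprMn (e3 (p ^ n)%:R) e2; ring.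
Qed.

Lemma cong_expX n x y : cong 1 x y -> cong n.+1 (x ^+ (p ^ n)) (y ^+ (p ^ n)).
Proof.
move=> h; elim: n => [|n IH]; first by rewrite expn0 !expr1.
by rewrite expnSr !exprM; apply: cong_exp.
Qed.

Hypothesis ntors : forall n (z : A), (p ^ n)%:R * z = 0 -> z = 0.

(** By induction the terms of index less than n of the n-th ghost components
    agree modulo p^(n+1), which leaves p^n a n = p^n b n modulo p^(n+1). *)
Lemma dwork N (a b : nat -> A) :
  (forall n, (n <= N)%N -> cong n.+1 (ghost p a n) (ghost p b n)) ->
  forall n, (n <= N)%N -> cong 1 (a n) (b n).
Proof.
move=> h n; elim/ltn_ind: n => n IH len.
case: (h n len) => u; rewrite /ghost !big_ord_recr /= subnn expn0 !expr1.
have [w ->] : cong n.+1 (\sum_(i < n) (p ^ i)%:R * a i ^+ (p ^ (n - i)))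
                        (\sum_(i < n) (p ^ i)%:R * b i ^+ (p ^ (n - i))).
  apply: cong_sum => i; have -> : n.+1 = (i + (n - i).+1)%N.
    by rewrite addnS subnKC // ltnW.
  by apply/cong_pM/cong_expX/IH => //; apply: leq_trans len; rewrite ltnW.
set S := \sum_(i < n) _ => e; exists (u - w); apply/eqP; rewrite -subr_eq0.
apply/eqP/(@ntors n); rewrite expn1.
have : (p ^ n)%:R * a n = (p ^ n)%:R * b n + (p ^ n.+1)%:R * (u - w).
  by apply: (addrI (S + (p ^ n.+1)%:R * w)); rewrite e; ring.
by move=> E; rewrite mulrBr E expnSr natrM; ring.
Qed.

End Dwork.

(** * The ring of Witt vectors *)

Section WittRing.
Variables (p : nat) (k : fieldType) (W : comNzRingType) (c : W -> nat -> k).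
Hypotheses (hk : perfect_char p k) (hW : is_Witt_ring p c).

Lemma perfect_prime : prime p.
Proof. by case: hk => /pcharf_prime. Qed.

Lemma wittPoly_ntors N n (z : wittPoly N) : (p ^ n)%:R * z = 0 -> z = 0.
Proof.
move=> h; apply/mpolyP => m; have := congr1 (mcoeff m) h.
rewrite mulr_natl mcoeffMn mcoeff0 => /eqP.
by rewrite mulrn_eq0 expn_eq0 (gtn_eqF (prime_gt0 perfect_prime)) /= => /eqP.
Qed.

(** Multiplication by p is the Frobenius followed by the shift.  For the generic
    vector X over Z, the ghost components of p X and of the shift of X^p agree
    modulo p^(n+1) by [ghost_shift_frob], so their coordinates agree modulo p. *)
Lemma witt_pmul a n :
  c (p%:R * a) n = if n is n'.+1 then c a n' ^+ p else 0.
Proof.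
have p_pr := perfect_prime.
case: hW => _ /(_ n) [S [P SP]].
pose X := wittX n.
(* The coordinates of the sum of r + 1 copies of X. *)
pose x := fix x r := if r is r'.+1 then fun m => wittEval (S m) (x r') X else X.
have gx r m : (m <= n)%N -> ghost p (x r) m = r.+1%:R * ghost p X m.
  move=> lem; elim: r => [|r IH]; first by rewrite mul1r.
  have [eS _ _ _] := SP m lem.
  rewrite [LHS](wittEval_ghostD lem eS (x r) X).
  by rewrite IH -[r.+2]addn1 natrD; ring.
pose f : {rmorphism wittPoly n -> k} := wittHom (N := n) (c a) (c a).
have fX i : (i <= n)%N -> f (X i) = c a i by move=> le; apply: wittHomX.
have cx r m : (m <= n)%N -> c (a *+ r.+1) m = f (x r m).
  elim: r m => [|r IH] m lem; first by rewrite fX.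
  case: (SP m lem) => _ _ cD _; rewrite mulrSr cD.
  rewrite [x r.+1 m]/= rmorph_wittEval; apply: eq_wittEval => i lei /=.
    by rewrite IH.
  by rewrite fX.
pose y m := if m is m'.+1 then X m' ^+ p else 0.
have gy m : (m <= n)%N -> cong p m.+1 (ghost p (x p.-1) m) (ghost p y m).
  move=> lem; rewrite gx // (prednK (prime_gt0 p_pr)).
  by exists (X m); apply: ghost_shift_frob; apply: prime_gt0.
have [u e] := dwork p_pr (@wittPoly_ntors n) gy (leqnn n).
rewrite mulr_natl -{1}(prednK (prime_gt0 p_pr)) cx // e rmorphD rmorphM rmorph_nat.
have -> : (p ^ 1)%:R = 0 :> k by case: hk => /pcharf0; rewrite expn1.
rewrite mul0r addr0; case: n => [|n'] in S P SP X x gx f fX cx y gy u e *; first by rewrite rmorph0.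
by rewrite /y rmorphXn fX.
Qed.

Lemma witt_inj a b : (forall n, c a n = c b n) -> a = b.
Proof. by case: hW => /bij_inj inj _ h; apply: inj; apply/funext. Qed.

Lemma witt_surj (x : nat -> k) : exists a, forall n, c a n = x n.
Proof. by case: hW => -[d _ dK] _; exists (d x) => n; rewrite dK. Qed.

Lemma witt_pX n a m : c (p%:R ^+ n * a) m =
  if (m < n)%N then 0 else c a (m - n) ^+ (p ^ n).
Proof.
elim: n m => [|n IH] m; first by rewrite expr0 mul1r subn0 expn0 expr1.
rewrite exprS -mulrA witt_pmul; case: m => [|m] //=.
rewrite IH ltnS; case: ltnP => _; last by rewrite -exprM -expnSr subSS.
by rewrite expr0n (gtn_eqF (prime_gt0 perfect_prime)).
Qed.

Lemma witt0 n : c 0 n = 0.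
Proof. by rewrite -(mulr0 (p%:R ^+ n.+1)) witt_pX ltnSn. Qed.

(** That the n first coordinates of a sum depend only on those of the terms
    follows from the universal polynomials with bound i < n, which have no
    variables of index larger than i. *)
Lemma witt_eqX n a b : (forall i, (i < n)%N -> c a i = c b i) <->
  exists u, a - b = p%:R ^+ n * u.
Proof.
split=> [e|[u e] i lt]; last first.
  have cN N : exists S : nat -> wittPoly N, forall m, (m <= N)%N -> forall a b : W,
    c (a + b) m = wittEval (S m) (c a) (c b).
    by case: hW => _ /(_ N) [S' [P' SP']]; exists S' => m /SP' [].
  have [T cT] := cN i.
  rewrite -(subrK b a) e addrC cT // -[in RHS](addr0 b) cT //.
  apply: eq_wittEval => m lem //.
  by rewrite witt_pX witt0 (leq_ltn_trans lem lt).
have e0 i : (i < n)%N -> c (a - b) i = 0.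
  move=> lt; case: hW => _ /(_ i) [S [P SP]]; case: (SP i (leqnn i)) => _ _ cD _.
  rewrite -(witt0 i) -(subrr b) !cD; apply: eq_wittEval => m lem //.
  by rewrite e // (leq_ltn_trans lem lt).
have rootE m x : exists y : k, y ^+ (p ^ m) = x.
  elim: m x => [|m IH] x; first by exists x; rewrite expn0 expr1.
  case: hk => _ /(_ x) [y <-]; case: (IH y) => z <-.
  by exists z; rewrite expnSr exprM.
have [y yE] := choice (fun i => rootE n (c (a - b) (i + n)%N)).
have [u uE] := witt_surj y; exists u; apply: witt_inj => m.
rewrite witt_pX; case: ltnP => [/e0 //|le].
by rewrite uE yE subnK.
Qed.

Lemma witt_div_pX n a : (exists u, a = p%:R ^+ n * u) <->
  (forall i, (i < n)%N -> c a i = 0).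
Proof.
rewrite -[X in exists u, X = _]subr0 -witt_eqX.
by split=> h i /h; rewrite witt0.
Qed.

Lemma wittM0 a b : c (a * b) 0 = c a 0%N * c b 0%N.
Proof.
case: hW => _ /(_ 0%N) [S [P SP]]; case: (SP 0%N (leqnn _)) => _ e _ ->.
move: e; rewrite /ghost !big_ord1 expn0 !mul1r !expr1 => ->.
by rewrite wittEvalE rmorphM /= wittHomX // wittHomY.
Qed.

Lemma witt1_0 : c 1 0 = 1.
Proof.
have [a aE] := witt_surj (fun=> 1).
by have := wittM0 1 a; rewrite mul1r !aE mulr1.
Qed.

Lemma wittX0 a n : c (a ^+ n) 0 = c a 0%N ^+ n.
Proof.
by elim: n => [|n IH]; rewrite ?witt1_0 // !exprS wittM0 IH.
Qed.

(** Modulo p only the first coordinate counts, and k is perfect. *)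
Lemma witt_frob (a : W) : exists b u, a = b ^+ p + p%:R * u.
Proof.
case: hk => _ /(_ (c a 0%N)) [y yE]; have [b bE] := witt_surj (fun=> y).
exists b; have [|u e] := (witt_eqX 1 a (b ^+ p)).1; last by exists u; rewrite -(expr1 (p%:R : W)) -e addrC subrK.
by case=> // _; rewrite wittX0 bE yE.
Qed.

(** The coordinates of the terms are eventually constant. *)
Lemma witt_complete (s : nat -> W) :
  (forall n, exists u, s n.+1 - s n = p%:R ^+ n * u) ->
  exists l, forall n, exists u, s n - l = p%:R ^+ n * u.
Proof.
move=> h; have st n i d : (i < n)%N -> c (s (n + d)%N) i = c (s n) i.
  move=> lt; elim: d => [|d IH]; first by rewrite addn0.
  by rewrite addnS -IH; apply: (witt_eqX (n + d) _ _).2 => //; rewrite ltn_addr.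
have [l lE] := witt_surj (fun i => c (s i.+1) i).
exists l => n; apply/witt_eqX => i lt; rewrite lE.
by rewrite -(subnKC lt) st.
Qed.

(** For b with the inverse first coordinate, a b = 1 + p t is inverted by a
    geometric series. *)
Lemma witt_unit a : c a 0 != 0 -> exists b, a * b = 1.
Proof.
move=> nz; have [b bE] := witt_surj (fun=> (c a 0%N)^-1).
have [t tE] : exists t, a * b - 1 = p%:R * t.
  rewrite -(expr1 (p%:R : W)); apply/witt_eqX => -[|//] _.
  by rewrite wittM0 bE divff // witt1_0.
pose g n := \sum_(i < n) (- (p%:R * t)) ^+ i.
have gE n : a * b * g n = 1 - (- (p%:R * t)) ^+ n.
  have := subrX1 (- (p%:R * t)) n; rewrite -/(g n) => e.
  have -> : a * b = 1 + p%:R * t by rewrite -tE addrC subrK.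
  by rewrite -(opprB _ 1) e; ring.
have [l lE] : exists l, forall n, exists u, g n - l = p%:R ^+ n * u.
  apply: witt_complete => n; exists ((- t) ^+ n).
  by rewrite /g big_ord_recr /= [X in X - _]addrC addrK -mulrN exprMn.
exists (b * l); rewrite mulrA; apply: witt_inj => n.
apply: (witt_eqX n.+1 _ _).2 => //; have [u uE] := lE n.+1.
exists (- (a * b * u) - (- t) ^+ n.+1).
have -> : l = g n.+1 - p%:R ^+ n.+1 * u by rewrite -uE; ring.
by rewrite mulrBr gE -(mulrN p%:R t) exprMn; ring.
Qed.

Lemma witt_factor a : a != 0 -> exists n u, a = p%:R ^+ n * u /\ c u 0 != 0.
Proof.
move=> nz; have : exists n, c a n != 0.
  apply/not_existsP => h; case/eqP: nz; apply: witt_inj => n.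
  by rewrite witt0; apply/eqP/negPn/negP; exact: h.
case/ex_minnP => n nn nmin; have [u uE] : exists u, a = p%:R ^+ n * u.
  apply/witt_div_pX => i lt; apply/eqP/negPn/negP => /nmin.
  by rewrite leqNgt lt.
exists n, u; split=> //; apply: contraNneq nn => e.
rewrite uE witt_pX ltnn subnn e expr0n expn_eq0.
by rewrite (gtn_eqF (prime_gt0 perfect_prime)).
Qed.

Lemma witt_ndvd u : c u 0 != 0 -> ~ exists w, u = p%:R * w.
Proof. by move=> nz [w e]; rewrite e witt_pmul eqxx in nz. Qed.

End WittRing.

(** * The fraction field of the Witt vectors *)

Section FractionField.
Variables (R : realType) (p : nat) (k : fieldType) (W : idomainType).
Variables (c : W -> nat -> k) (v : {fraction W} -> \bar R).
Hypotheses (hk : perfect_char p k) (hW : is_Witt_ring p c).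
Hypothesis hp : is_padic_valuation p v.

Let hv : is_valuation v. Proof. by case: hp. Qed.

Lemma padic_pX n (u : W) : c u 0%N != 0 -> v (tofrac (p%:R ^+ n * u)) = n%:R%:E.
Proof.
move=> nz; case: hp => _ /(_ (p%:R ^+ n * u) n) [_ ->] //.
split; first by exists u.
case=> w e; apply: (witt_ndvd hk hW nz); exists w.
have pn : (p%:R : W) ^+ n != 0.
  rewrite expf_neq0 //; apply/eqP => p0.
  have := witt_pmul hk hW 1 1; rewrite p0 mul0r (witt0 hk hW) (witt1_0 hW) => /eqP.
  by rewrite expr1n eq_sym oner_eq0.
by apply: (mulfI pn); rewrite e exprSr mulrA.
Qed.

Lemma padic_ge0 (w : W) : vge v 0 (tofrac w).
Proof.
have [->|nz] := eqVneq w 0; first by rewrite tofrac0; exact: vge0.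
have [n [u [-> nu]]] := witt_factor hk hW nz.
by rewrite /vge padic_pX // lee_fin.
Qed.

Lemma padic_p : vr v p%:R = 1.
Proof.
have nz : c 1 0%N != 0 by rewrite (witt1_0 hW) oner_eq0.
by have := padic_pX 1 nz; rewrite mulr1 expr1 rmorph_nat /vr => ->.
Qed.

Lemma padic_p_neq0 : (p%:R : {fraction W}) != 0.
Proof.
apply/eqP => p0; have := padic_p; rewrite p0 /vr.
case: hv => _ /(_ 0) [_ ->] // _ _ /eqP; by rewrite eq_sym oner_eq0.
Qed.

Lemma padic_geX n (w : W) : vge v n%:R (tofrac w) <-> exists u, w = p%:R ^+ n * u.
Proof.
split=> [h|[u ->]].
  have [->|nz] := eqVneq w 0; first by exists 0; rewrite mulr0.
  have [m [u [e nu]]] := witt_factor hk hW nz.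
  move: h; rewrite e /vge padic_pX // lee_fin ler_nat => le.
  by exists (p%:R ^+ (m - n) * u); rewrite mulrA -exprD subnKC.
rewrite rmorphM; apply: (vgeMr hv); last exact: padic_ge0.
rewrite rmorphXn rmorph_nat; have := vgeX hv n (vge_vr hv p%:R).
by rewrite padic_p.
Qed.

Lemma fraction_quotient (a : {fraction W}) :
  exists x y : W, y != 0 /\ a = tofrac x / tofrac y.
Proof.
elim/quotW: a => r; exists (frac r).1, (frac r).2.
have nd : (frac r).2 != 0 := denom_ratioP r.
split=> //; apply: (canRL (mulfK _)); first by rewrite tofrac_eq0.
apply/eqP; rewrite !piE FracField.equivfE /FracField.mulf.
by rewrite !numden_Ratio ?mulr1 ?oner_eq0 // mulrC.
Qed.

Lemma padic_factor (a : {fraction W}) : a != 0 ->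
  exists (z : int) (w : W), vr v a = z%:~R /\ a = p%:R ^ z * tofrac w.
Proof.
move=> na; have [x [y [ny e]]] := fraction_quotient a.
have nx : x != 0 by apply: contraNneq na => x0; rewrite e x0 tofrac0 mul0r.
have [n [u [ex nu]]] := witt_factor hk hW nx.
have [m [w [ey nw]]] := witt_factor hk hW ny.
have [t tE] := witt_unit hk hW nw.
have nw0 : w != 0 by apply: contraNneq nw => ->; rewrite (witt0 hk hW).
have nt : tofrac t = (tofrac w)^-1.
  have nw1 : tofrac w != 0 by rewrite tofrac_eq0.
  by apply: (mulfI nw1); rewrite -tofracM tE tofrac1 divff.
exists (n%:Z - m%:Z), (u * t); split.
  rewrite e (vrM hv) ?invr_eq0 ?tofrac_eq0 // (vrV hv) ?tofrac_eq0 //.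
  by rewrite {1}/vr {1}/vr ex ey !padic_pX //= rmorphB.
rewrite e ex ey expfzDr ?padic_p_neq0 // -invr_expz -!exprnP.
by rewrite !tofracM nt !tofracXn !rmorph_nat invfM; ring.
Qed.

Lemma padic_int a : a != 0 -> exists z : int, vr v a = z%:~R.
Proof. by move=> /padic_factor [z [w [e _]]]; exists z. Qed.

Lemma padic_tofrac a : vge v 0 a -> exists w, a = tofrac w.
Proof.
have [->|na] := eqVneq a 0; first by exists 0; rewrite tofrac0.
move=> /(vgeE hv _ na); have [z [w [-> ->]]] := padic_factor na.
rewrite ler0z; case: z => // n _; exists (p%:R ^+ n * w).
by rewrite rmorphM rmorphXn rmorph_nat.
Qed.

Lemma padic_frob a : vge v 0 a -> exists2 b, vge v 0 b & vge v 1 (a - b ^+ p).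
Proof.
case/padic_tofrac=> w ->; have [b [u e]] := witt_frob hk hW w.
exists (tofrac b); first exact: padic_ge0.
by rewrite -tofracXn -tofracB; apply/(padic_geX 1); exists u; rewrite e addrC addKr expr1.
Qed.

(** Up to a translation the sequence takes its values in W from some index on;
    there [witt_complete] applies to a subsequence. *)
Lemma padic_complete (a : nat -> {fraction W}) :
  v_cauchy v a -> exists l, v_converges v a l.
Proof.
move=> ca; have [N0 hN0] := ca 0.
have [w wE] := choice (fun n : nat =>
  padic_tofrac (hN0 (n + N0)%N N0 (leq_addl _ _) (leqnn _))).
have [N hN] := choice (fun m : nat => ca m%:R).
pose idx m := \max_(i < m.+1) N i.
have idx_le m i : (i <= m)%N -> (N i <= idx m)%N.
  move=> le; rewrite -[X in N X](@inordK m) //.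
  exact: (@leq_bigmax _ (fun i : 'I_m.+1 => N i) (inord i)).
have dvd m x y : (N m <= x)%N -> (N m <= y)%N -> exists u, w x - w y = p%:R ^+ m * u.
  move=> hx hy; apply/padic_geX; rewrite tofracB -!wE opprB addrA subrK.
  by apply: hN; rewrite (leq_trans _ (leq_addr _ _)).
have [l lE] : exists l, forall n, exists u, w (idx n) - l = p%:R ^+ n * u.
  by apply: (witt_complete hk hW) => m; apply: dvd; apply: idx_le.
exists (tofrac l + a N0) => B.
pose m := Num.bound `|B|.
have Bm : B <= m%:R.
  by apply: le_trans (ler_norm B) (ltW (archi_boundP (normr_ge0 _))).
exists (N m + N0)%N => n len; apply: (vgeW (r := m%:R) Bm).
have ltn : (N0 <= n)%N by apply: leq_trans len; rewrite leq_addl.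
have -> : a n - (tofrac l + a N0) = tofrac (w (n - N0)%N - l).
  by rewrite tofracB -wE subnK //; ring.
apply/padic_geX; have [u1 e1] := lE m.
have [|u2 e2] := dvd m (n - N0)%N (idx m) _ (idx_le m m (leqnn m)).
  by rewrite -(leq_add2r N0) subnK.
by exists (u2 + u1); rewrite mulrDr -e2 -e1; ring.
Qed.

End FractionField.

(** * Uniqueness of the extension of a complete valuation *)

Lemma min_size_poly (T : nzRingType) (Q : {poly T} -> Prop) :
  (exists P, Q P) -> exists P, Q P /\ forall P', Q P' -> (size P <= size P')%N.
Proof.
case=> P0 QP0; have : exists n, `[< exists2 P, Q P & size P = n >].
  by exists (size P0); apply/asboolP; exists P0.
case/ex_minnP => n /asboolP [P QP sP] nmin; exists P; split=> // P' QP'.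
by rewrite sP; apply: nmin; apply/asboolP; exists P'.
Qed.

Section UniqueExtension.
Variables (R : realType) (F L : fieldType) (phi : {rmorphism F -> L}).

Definition complete_for (v : L -> \bar R) : Prop :=
  forall u : nat -> F, v_cauchy (v \o phi) u ->
  exists l, v_converges (v \o phi) u l.

Definition lin_indep (d : nat) (e : nat -> L) : Prop :=
  forall c : nat -> F, \sum_(i < d) phi (c i) * e i = 0 ->
  forall i, (i < d)%N -> c i = 0.

Section OneValuation.
Variable v : L -> \bar R.
Hypotheses (hv : is_valuation v) (cv : complete_for v).

(** If vectors e_d + (combination of the others) came arbitrarily close to 0,
    their coefficients would form Cauchy sequences, whose limits would give a
    linear relation. *)
Lemma indep_away d (e : nat -> L) (B : R) : lin_indep d.+1 e ->
  (forall (c : nat -> F) D, vge v D (\sum_(i < d) phi (c i) * e i) ->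
     forall i, (i < d)%N -> vge v (D - B) (phi (c i))) ->
  exists B' : R, forall c : nat -> F, ~ vge v B' (e d + \sum_(i < d) phi (c i) * e i).
Proof.
move=> ind bound; apply/not_existsP => h.
have [C hC] : exists C : nat -> nat -> F, forall n,
    vge v n%:R (e d + \sum_(i < d) phi (C n i) * e i).
  have ex (n : nat) : exists c : nat -> F, vge v n%:R (e d + \sum_(i < d) phi (c i) * e i).
    by have /existsNP [c /contrapT hc] := h n%:R; exists c.
  by have [C hC] := choice ex; exists C.
have cauchy i : (i < d)%N -> v_cauchy (v \o phi) (fun n => C n i).
  move=> lt D; have := archi_boundP (normr_ge0 (D + B)); set N := Num.bound _ => hN.
  exists N => m n lem len /=; apply: (vgeW (r := N%:R - B)).
    by have := ler_norm (D + B); lra.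
  apply: (bound (fun i => C m i - C n i)) => //.
  under eq_bigr do rewrite rmorphB mulrBl; rewrite sumrB.
  rewrite [X in vge v _ X](_ : _ = (e d + \sum_(i < d) phi (C m i) * e i)
     - (e d + \sum_(i < d) phi (C n i) * e i)); last by ring.
  by apply: (vgeB hv); [apply: vgeW (hC m)|apply: vgeW (hC n)]; rewrite ler_nat.
have lim (i : nat) : exists x, (i < d)%N -> v_converges (v \o phi) (fun n => C n i) x.
  case: (ltnP i d) => [lt|_]; last by exists 0.
  by have [x hx] := cv (cauchy i lt); exists x.
have [l hl] := choice lim.
suff e0 : \sum_(i < d.+1) phi (if (i < d)%N then l i else 1) * e i = 0.
  have := ind (fun i => if (i < d)%N then l i else 1) e0 d (ltnSn d).
  by rewrite ltnn => /eqP; rewrite oner_eq0.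
rewrite big_ord_recr /= ltnn rmorph1 mul1r.
rewrite (eq_bigr (fun i : 'I_d => phi (l i) * e i)) => [|i _]; last by rewrite ltn_ord.
apply: (vge_eq0 hv) => n.
have near (i : nat) : exists N : nat, (i < d)%N -> forall m, (N <= m)%N ->
    vge v (n%:R - vr v (e i)) (phi (C m i - l i)).
  case: (ltnP i d) => [lt|_]; last by exists 0%N.
  by have [N hN] := hl i lt (n%:R - vr v (e i)); exists N.
have [N hN] := choice near.
pose m := maxn n (\max_(i < d) N i).
rewrite [X in vge v _ X](_ : _ = (e d + \sum_(i < d) phi (C m i) * e i)
  - \sum_(i < d) phi (C m i - l i) * e i); last first.
  have -> : \sum_(i < d) phi (C m i - l i) * e i
      = \sum_(i < d) phi (C m i) * e i - \sum_(i < d) phi (l i) * e i.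
    by rewrite -sumrB; apply: eq_bigr => i _; rewrite rmorphB mulrBl.
  by ring.
apply: (vgeB hv).
  by apply: vgeW (hC m); rewrite ler_nat leq_maxl.
apply: vge_sum => // i _; rewrite -(subrK (vr v (e i)) n%:R).
apply: (vgeM hv); last exact: vge_vr.
apply: hN => //; rewrite /m leq_max; apply/orP; right.
exact: (@leq_bigmax _ (fun i : 'I_d => N i) i).
Qed.

(** By induction on d: by [indep_away] the last coordinate is controlled by the
    vector, hence so is the combination of the other ones. *)
Lemma indep_bound d (e : nat -> L) : lin_indep d e ->
  exists B : R, forall (c : nat -> F) D, vge v D (\sum_(i < d) phi (c i) * e i) ->
    forall i, (i < d)%N -> vge v (D - B) (phi (c i)).
Proof.
elim: d => [|d IH] ind; first by exists 0.
have ind' : lin_indep d e.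
  move=> c e0 i lt; have := ind (fun i => if (i < d)%N then c i else 0) _ i (ltnW lt).
  rewrite lt; apply; rewrite big_ord_recr /= ltnn rmorph0 mul0r addr0 -[RHS]e0.
  by apply: eq_bigr => k _; rewrite ltn_ord.
have [B0 hB0] := IH ind'; have [B1 hB1] := indep_away ind hB0.
pose B2 := Num.max 0 (B1 - vr v (e d)).
exists (Num.max B1 (B2 + B0)) => c D; rewrite big_ord_recr /= => hD.
have hd : vge v (D - B1) (phi (c d)).
  have [->|nc] := eqVneq (c d) 0; first by rewrite rmorph0; exact: vge0.
  have nphi : phi (c d) != 0 by rewrite fmorph_eq0.
  apply/(vgeE hv _ nphi); rewrite leNgt; apply/negP => lt.
  apply: (hB1 (fun i => c i / c d)); apply: (vgeMI hv nphi).
  rewrite mulrDl [X in vge _ _ X]addrC mulr_suml.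
  rewrite (eq_bigr (fun i : 'I_d => phi (c i) * e i)) => [|i _]; last first.
    by rewrite fmorph_div mulrAC divfK.
  by rewrite [e d * _]mulrC; apply: vgeW hD; lra.
have hs : vge v (D - B2) (\sum_(i < d) phi (c i) * e i).
  rewrite -[X in vge v _ X](addrK (phi (c d) * e d)); apply: (vgeB hv).
    by apply: vgeW hD; rewrite gerBl le_max lexx.
  apply: vgeW (vgeM hv hd (vge_vr hv (e d))).
  have : B1 - vr v (e d) <= B2 by rewrite le_max lexx orbT.
  lra.
move=> i; rewrite ltnS leq_eqVlt => /orP [/eqP ->|lt].
  by apply: vgeW hd; rewrite lerD2l lerN2 le_max lexx.
apply: vgeW (hB0 c _ hs i lt).
have : B2 + B0 <= Num.max B1 (B2 + B0) by rewrite le_max lexx orbT.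
lra.
Qed.

End OneValuation.

(** The valuations of the powers of z are governed, up to a bounded error, by
    their coordinates over F on a basis of F(z); hence the valuation of z by the
    valuation of F. *)
Lemma extension_le (v v' : L -> \bar R) z :
  is_valuation v -> is_valuation v' -> complete_for v ->
  (forall a, v (phi a) = v' (phi a)) ->
  algebraicOver phi z -> z != 0 -> vr v z <= vr v' z.
Proof.
move=> hv hv' cv vv' alg nz.
have [P [[nP rP] minP]] : exists P : {poly F}, (P != 0 /\ root (map_poly phi P) z) /\
    forall P' : {poly F}, P' != 0 /\ root (map_poly phi P') z -> (size P <= size P')%N.
  by apply: min_size_poly; case: alg => P nP rP; exists P.
pose d := (size P).-1.
have sP : size P = d.+1 by rewrite prednK // size_poly_gt0.
have hornE (Q : {poly F}) : (size Q <= d)%N -> (map_poly phi Q).[z] = \sum_(i < d) phi Q`_i * z ^+ i.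
  move=> sQ; rewrite (@horner_coef_wide _ d) ?size_map_poly //.
  by apply: eq_bigr => i _; rewrite coef_map.
have ind : lin_indep d (fun i => z ^+ i).
  move=> c e0 i lt; pose Q := \poly_(j < d) c j.
  have sQ : (size Q <= d)%N by apply: size_poly.
  have Q0 : Q = 0.
    apply/eqP/negPn/negP => nQ; have /minP : Q != 0 /\ root (map_poly phi Q) z.
      split=> //; apply/rootP; rewrite hornE // -[RHS]e0; apply: eq_bigr => j _.
      by rewrite coef_poly ltn_ord.
    by rewrite sP ltnNge sQ.
  by have := coef_poly d c i; rewrite -/Q Q0 coef0 lt.
have [B hB] := indep_bound hv cv ind.
pose a := vr v z; pose b := vr v' z; pose K := d%:R * `|b|.
have key (n : nat) : a *+ n - B - K <= b *+ n.
  pose Q := 'X^n %% P.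
  have sQ : (size Q <= d)%N by rewrite -ltnS -sP ltn_modp.
  have znE : z ^+ n = \sum_(i < d) phi Q`_i * z ^+ i.
    rewrite -hornE // -[LHS]hornerXn -(map_polyXn phi) [in LHS](divp_eq 'X^n P).
    by rewrite rmorphD rmorphM hornerD hornerM (rootP rP) mulr0 add0r.
  have hn : vge v' (a *+ n - B - K) (z ^+ n).
    rewrite znE; apply: vge_sum => // i _; apply: (vgeM hv').
      rewrite /vge -vv'; apply: hB (ltn_ord i); rewrite -znE.
      by apply: vgeX => //; apply: vge_vr.
    apply: vgeW (vgeX hv' i (vge_vr hv' z)).
    rewrite -/b /K -mulr_natl; have := ler_norm (- b); rewrite normrN => h1.
    have h2 : (i%:R : R) <= d%:R by rewrite ler_nat ltnW.
    have h3 : (0 : R) <= i%:R by [].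
    have := normr_ge0 b; nra.
  by move: hn => /(vgeE hv' _ (expf_neq0 n nz)); rewrite vrX.
rewrite leNgt; apply/negP => lt.
have gt0 : 0 < a - b by rewrite subr_gt0.
have [n hn] : exists n : nat, B + K < n%:R * (a - b).
  exists (Num.bound `|(B + K) / (a - b)|); rewrite -ltr_pdivrMr //.
  exact: le_lt_trans (ler_norm _) (archi_boundP (normr_ge0 _)).
have := key n; rewrite -(mulr_natl a) -(mulr_natl b) => h.
by move: hn; rewrite ltNge => /negP; apply; lra.
Qed.

Lemma unique_extension (v v' : L -> \bar R) z :
  is_valuation v -> is_valuation v' -> complete_for v ->
  (forall a, v (phi a) = v' (phi a)) ->
  algebraicOver phi z -> v z = v' z.
Proof.
move=> hv hv' cv vv' alg; have [->|nz] := eqVneq z 0.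
  by rewrite -(rmorph0 phi) vv'.
rewrite (v_vr hv nz) (v_vr hv' nz); congr (_ %:E); apply/eqP; rewrite eq_le.
rewrite !extension_le // => u cu.
have [|l hl] := cv u.
  move=> D; have [N hN] := cu D; exists N => m n hm hn /=.
  by rewrite vv'; exact: hN.
exists l => D; have [N hN] := hl D; exists N => n hn /=.
by rewrite -vv'; exact: hN.
Qed.

End UniqueExtension.

(** * Subfields as predicates *)

Section SubfieldPredicates.
Variable L : fieldType.

Definition subfield_pred (B : L -> Prop) : Prop :=
  [/\ B 1, forall a b, B a -> B b -> B (a - b),
      forall a b, B a -> B b -> B (a * b) & forall a, B a -> B a^-1].

Definition coefs_in (B : L -> Prop) (P : {poly L}) : Prop := forall i, B P`_i.

Definition algebraic_pred (B : L -> Prop) : Prop :=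
  forall z, exists P, [/\ P != 0, coefs_in B P & P.[z] = 0].

Variable B : L -> Prop.
Hypothesis (hB : subfield_pred B).

Lemma subfield0 : B 0.
Proof. by case: hB => B1 BB _ _; rewrite -(subrr 1); apply: BB. Qed.

Lemma subfieldN a : B a -> B (- a).
Proof. by case: hB => B1 BB _ _ Ba; rewrite -sub0r; apply: BB => //; exact: subfield0. Qed.

Lemma subfieldD a b : B a -> B b -> B (a + b).
Proof. by case: hB => B1 BB _ _ Ba Bb; rewrite -(opprK b); apply: BB => //; exact: subfieldN. Qed.

Lemma subfieldM a b : B a -> B b -> B (a * b).
Proof. by case: hB => _ _ BM _; apply: BM. Qed.

Lemma subfieldX a n : B a -> B (a ^+ n).
Proof.
move=> Ba; elim: n => [|n IH]; first by case: hB.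
by rewrite exprS; apply: subfieldM.
Qed.

Lemma subfield_sum (I : Type) (s : seq I) (P : pred I) (f : I -> L) :
  (forall i, P i -> B (f i)) -> B (\sum_(i <- s | P i) f i).
Proof. by move=> h; elim/big_ind: _ => //; [exact: subfield0|exact: subfieldD]. Qed.

Lemma subfield_nat n : B n%:R.
Proof.
elim: n => [|n IH]; first exact: subfield0.
by rewrite -addn1 natrD; apply: subfieldD => //; case: hB.
Qed.

Lemma coefs_in_mul P Q : coefs_in B P -> coefs_in B Q -> coefs_in B (P * Q).
Proof.
by move=> hP hQ k; rewrite coefM; apply: subfield_sum => i _; apply: subfieldM.
Qed.

Lemma coefs_in_C a : B a -> coefs_in B a%:P.
Proof. by move=> Ba k; rewrite coefC; case: eqP => // _; exact: subfield0. Qed.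

Lemma coefs_in_comp P Q : coefs_in B P -> coefs_in B Q -> coefs_in B (P \Po Q).
Proof.
move=> hP hQ k; rewrite coef_comp_poly; apply: subfield_sum => i _.
apply: subfieldM => //; elim: (nat_of_ord i) k => [|n IH] k.
  by rewrite expr0; apply: coefs_in_C; case: hB.
by rewrite exprS; apply: coefs_in_mul.
Qed.

(** If f is a polynomial of least degree that kills a, then its constant term is
    not 0, and f(X) = f(0) + g(X) X gives a g(a) = - f(0). *)
Lemma algebraic_inverse (a : L) : algebraic_pred B -> a != 0 ->
  exists H, coefs_in B H /\ a * H.[a] = 1.
Proof.
move=> alg na.
have [f [[nf hf fa] minf]] := min_size_poly (alg a).
pose g := \poly_(i < size f) f`_i.+1.
have hg : coefs_in B g.
  by move=> k; rewrite coef_poly; case: ifP => _; [exact: hf|exact: subfield0].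
have fE : f = (f`_0)%:P + g * 'X.
  apply/polyP => -[|k]; rewrite coefD coefC coefMX /=; first by rewrite addr0.
  rewrite add0r coef_poly; case: ltnP => // le.
  by rewrite nth_default // ltnW.
have ga : f`_0 + g.[a] * a = 0.
  by have := fa; rewrite {1}fE hornerD hornerC hornerM hornerX.
have f0 : f`_0 != 0.
  apply/eqP => f0; have : (size f <= size g)%N.
    apply: minf; split=> //; last first.
      by move: ga; rewrite f0 add0r => /eqP; rewrite mulf_eq0 (negPf na) orbF => /eqP.
    by apply: contraNneq nf => g0; rewrite fE g0 f0 mul0r addr0.
  have g0 : g != 0 by apply: contraNneq nf => g0; rewrite fE g0 f0 mul0r addr0.
  by rewrite fE f0 add0r size_mulX // ltnn.
exists ((- (f`_0)^-1)%:P * g); split.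
  apply: coefs_in_mul => //; apply: coefs_in_C; apply: subfieldN.
  by case: hB => _ _ _; apply; apply: hf.
rewrite hornerM hornerC; have -> : a * (- (f`_0)^-1 * g.[a]) = - (f`_0)^-1 * (g.[a] * a) by ring.
by rewrite -(addr0_eq ga) mulNr mulrN opprK mulVf.
Qed.

End SubfieldPredicates.

(** * Extension of embeddings *)
Section Embeddings.
Variables (L : closedFieldType) (B : L -> Prop).
Hypotheses (hB : subfield_pred B) (algB : algebraic_pred B).

(** A homomorphism over B from a subring of L to L, given by its graph. *)
Definition partial_hom (G : L -> L -> Prop) : Prop :=
  [/\ forall a, B a -> G a a,
      forall a b a' b', G a b -> G a' b' -> G (a - a') (b - b'),
      forall a b a' b', G a b -> G a' b' -> G (a * a') (b * b')
    & forall b, G 0 b -> b = 0].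

Definition coefs_rel (G : L -> L -> Prop) (P Q : {poly L}) : Prop :=
  forall k, G P`_k Q`_k.

(** The candidate for an extension of G that maps t to t'. *)
Definition adjoin_rel (G : L -> L -> Prop) (t t' a b : L) : Prop :=
  exists P Q, [/\ coefs_rel G P Q, a = P.[t] & b = Q.[t']].

Section OneHom.
Variable G : L -> L -> Prop.
Hypothesis hG : partial_hom G.

Lemma hom00 : G 0 0.
Proof. by case: hG => h _ _ _; apply: h; exact: subfield0. Qed.

Lemma hom_fun a b b' : G a b -> G a b' -> b = b'.
Proof.
case: hG => _ hS _ h0 h h'; apply/eqP; rewrite -subr_eq0; apply/eqP/h0.
by rewrite -(subrr a); apply: hS.
Qed.

Lemma homD a b a' b' : G a b -> G a' b' -> G (a + a') (b + b').
Proof.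
case: hG => _ hS _ _ h h'; rewrite -(opprK a') -(opprK b').
by apply: (hS) => //; rewrite -(sub0r a') -(sub0r b'); apply: hS => //; exact: hom00.
Qed.

Lemma coefs_relB P Q P' Q' : coefs_rel G P Q -> coefs_rel G P' Q' ->
  coefs_rel G (P - P') (Q - Q').
Proof. by case: hG => _ hS _ _ h h' k; rewrite !coefB; apply: hS. Qed.

Lemma coefs_relM P Q P' Q' : coefs_rel G P Q -> coefs_rel G P' Q' ->
  coefs_rel G (P * P') (Q * Q').
Proof.
case: hG => _ _ hM _ h h' k; rewrite !coefM.
by elim/big_ind2: _ => [||i _]; [exact: hom00|move=> *; exact: homD|exact: hM].
Qed.

Lemma coefs_relC a b : G a b -> coefs_rel G a%:P b%:P.
Proof. by move=> h k; rewrite !coefC; case: eqP => // _; exact: hom00. Qed.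

Lemma coefs_rel_diag P : coefs_in B P -> coefs_rel G P P.
Proof. by case: hG => h _ _ _ hP k; apply: h. Qed.

Lemma coefs_in_Xn n : coefs_in B 'X^n.
Proof.
by move=> k; rewrite coefXn; case: eqP => _; [case: hB|exact: subfield0].
Qed.

Lemma coefs_rel0 Q : coefs_rel G 0 Q -> Q = 0.
Proof. by case: hG => _ _ _ h0 h; apply/polyP => k; rewrite coef0; apply: h0; have := h k; rewrite coef0. Qed.

(** The inverse of a is a polynomial in a over B, on which G is determined. *)
Lemma homV a b : G a b -> a != 0 -> G a^-1 b^-1.
Proof.
move=> h na; have [H [hH aH]] := algebraic_inverse hB algB na.
case: (hG) => hd _ hM _.
have hHab : G H.[a] H.[b].
  rewrite !horner_coef; elim/big_ind2: _ => [||i _]; [exact: hom00|move=> *; exact: homD|].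
  apply: (hM); first by apply: (hd).
  elim: (nat_of_ord i) => [|n IH]; first by apply: (hd); case: hB.
  by rewrite !exprS; apply: (hM).
have bH : b * H.[b] = 1.
  apply: (@hom_fun 1); last by apply: (hd); case: hB.
  by rewrite -aH; apply: (hM).
have -> : a^-1 = H.[a] by apply: (mulfI na); rewrite aH divff.
have nb : b != 0 by apply/eqP => b0; move/eqP: bH; rewrite b0 mul0r eq_sym oner_eq0.
by have -> : b^-1 = H.[b] by apply: (mulfI nb); rewrite bH divff.
Qed.

Lemma adjoin_rel_sub t t' a b : G a b -> adjoin_rel G t t' a b.
Proof.
by move=> h; exists a%:P, b%:P; rewrite !hornerC; split=> //; exact: coefs_relC.
Qed.

Lemma adjoin_rel_gen t t' : adjoin_rel G t t' t t'.
Proof.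
exists 'X, 'X; rewrite !hornerX; split=> //; rewrite -['X]expr1.
exact/coefs_rel_diag/coefs_in_Xn.
Qed.

(** t may be sent to any root of the image of its minimal polynomial: reducing
    P' modulo the minimal polynomial P of t in parallel with Q' modulo Q, the
    remainder of P' has to vanish when P' kills t. *)
Lemma adjoin_rel_hom t t' P Q : coefs_rel G P Q -> P \is monic ->
  P.[t] = 0 -> Q.[t'] = 0 ->
  (forall P' Q', coefs_rel G P' Q' -> P'.[t] = 0 -> (size P' < size P)%N -> P' = 0) ->
  partial_hom (adjoin_rel G t t').
Proof.
move=> hPQ mP Pt Qt minP; case: (hG) => hd hS hM h0; split.
- by move=> a Ba; apply/adjoin_rel_sub/hd.
- move=> a b a' b' [U [V [hUV -> ->]]] [U' [V' [hUV' -> ->]]].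
  by exists (U - U'), (V - V'); rewrite !hornerD !hornerN; split=> //; exact: coefs_relB.
- move=> a b a' b' [U [V [hUV -> ->]]] [U' [V' [hUV' -> ->]]].
  by exists (U * U'), (V * V'); rewrite !hornerM; split=> //; exact: coefs_relM.
move=> b [U [V [hUV e ->]]]; move: e => /esym.
have [n] := ubnP (size U); elim: n U V hUV => // n IH U V hUV.
rewrite ltnS => sU Ut.
have [lt|le] := ltnP (size U) (size P).
  have U0 := minP _ _ hUV Ut lt.
  by move: hUV; rewrite U0 => /coefs_rel0 ->; rewrite horner0.
have sP0 : (0 < size P)%N by rewrite size_poly_gt0 monic_neq0.
have sU0 : (0 < size U)%N by apply: leq_trans le.
pose m := (size U - size P)%N; pose u := lead_coef U; pose w := V`_(size U).-1.
have huw : coefs_rel G (u%:P * 'X^m * P) (w%:P * 'X^m * Q).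
  apply: coefs_relM => //; apply: coefs_relM.
    by apply: coefs_relC; rewrite /u lead_coefE; apply: hUV.
  exact/coefs_rel_diag/coefs_in_Xn.
have := IH _ _ (coefs_relB hUV huw).
rewrite !hornerD !hornerN !hornerM Ut Pt Qt !mulr0 !subr0; apply=> //.
apply: (leq_trans _ sU); rewrite -(prednK sU0) ltnS; apply/leq_sizeP => k lek.
have mk : (m <= k)%N.
  by apply: leq_trans lek; rewrite /m -subn1 leq_sub2l.
rewrite coefB -mulrA coefCM coefXnM ltnNge mk /=.
move: lek; rewrite leq_eqVlt => /orP [/eqP <-|lt].
  have -> : ((size U).-1 - m = (size P).-1)%N.
    rewrite /m -subn1 -subnDA addnC subnDA subKn // subn1 //.
  by rewrite -!lead_coefE (monicP mP) mulr1 subrr.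
rewrite prednK // in lt; rewrite (nth_default _ lt).
rewrite (nth_default _ (_ : size P <= k - m)%N) ?mulr0 ?subr0 //.
by rewrite -(leq_add2r m) subnK // /m subnKC.
Qed.

(** Among the polynomials with coefficients in the domain of G, take a monic one
    of least degree that kills t.  Its image under G has the same degree, hence a
    root t' in L. *)
Lemma extend_hom t : exists G', [/\ partial_hom G', forall a b, G a b -> G' a b
  & exists t', G' t t'].
Proof.
have exP : exists P, [/\ P != 0, P.[t] = 0 & exists Q, coefs_rel G P Q].
  have [P [nP hP Pt]] := algB t; exists P; split=> //.
  by exists P; apply: coefs_rel_diag.
have [P0 [[nP0 P0t [Q0 hPQ0]] minP0]] := min_size_poly exP.
have nl : lead_coef P0 != 0 by rewrite lead_coef_eq0.
have hl : G (lead_coef P0)^-1 (Q0`_(size P0).-1)^-1.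
  by apply: homV => //; rewrite lead_coefE; apply: hPQ0.
pose P := (lead_coef P0)^-1%:P * P0; pose Q := (Q0`_(size P0).-1)^-1%:P * Q0.
have hPQ : coefs_rel G P Q by apply: coefs_relM => //; apply: coefs_relC.
have sPP : size P = size P0 by rewrite size_Cmul ?invr_eq0.
have mP : P \is monic by rewrite monicE lead_coefM lead_coefC mulVf.
have Pt : P.[t] = 0 by rewrite hornerM P0t mulr0.
have sP : (1 < size P)%N.
  rewrite ltnNge; apply/negP => /size1_polyC e.
  by move: Pt mP; rewrite e hornerC monicE lead_coefC => ->; rewrite eq_sym oner_eq0.
have Q1 : Q`_(size P).-1 = 1.
  apply: (hom_fun (a := 1)); last by case: hG => hd _ _ _; apply: (hd); case: hB.
  by have := hPQ (size P).-1; rewrite -lead_coefE (monicP mP).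
have sQ : (1 < size Q)%N.
  rewrite ltnNge; apply/negP => le; move/eqP: Q1.
  rewrite nth_default ?(eq_sym 0) ?oner_eq0 //.
  by apply: leq_trans le _; rewrite -ltnS prednK // ltnW.
have [t' /rootP Qt] : exists t', root Q t' by apply/closed_rootP; rewrite gtn_eqF.
exists (adjoin_rel G t t'); split; last by exists t'; exact: adjoin_rel_gen.
  apply: (adjoin_rel_hom hPQ mP Pt Qt) => P' Q' hPQ' P't.
  rewrite sPP ltnNge => h; apply/eqP/negPn/negP => nP'; move/negP: h; apply.
  by apply: minP0; split=> //; exists Q'.
by move=> a b; apply: adjoin_rel_sub.
Qed.

End OneHom.

(** By Zorn's lemma there is a maximal partial homomorphism; by [extend_hom] its
    domain is L. *)
Lemma hom_total G : partial_hom G ->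
  exists G', [/\ partial_hom G', forall a b, G a b -> G' a b
  & forall t, exists t', G' t t'].
Proof.
move=> hG; pose rel_of (X : set (L * L)) a b := X (a, b).
pose ok (X : set (L * L)) := partial_hom (rel_of X) /\ forall a b, G a b -> X (a, b).
have [A [okA maxA]] : exists A, (A = set0 \/ ok A) /\
    forall X, (A `<` X)%classic -> ~ (X = set0 \/ ok X).
  apply: Zorn_bigcup => S hS tot.
  (* The empty chain has the empty union, whence the case A = set0. *)
  have [[X0 [SX0 nX0]]|none] := pselect (exists X, S X /\ X <> set0); last first.
    left; apply/seteqP; split=> // x [X SX Xx]; apply: none; exists X; split=> //.
    by move=> X0; move: Xx; rewrite X0.
  have okS X a b : S X -> X (a, b) -> ok X.
    by move=> SX Xx; case: (hS X SX) => // e; move: Xx; rewrite e.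
  have okX0 : ok X0 by case: (hS X0 SX0).
  have join X Y a b a' b' : S X -> S Y -> X (a, b) -> Y (a', b') ->
      exists Z, [/\ S Z, ok Z, Z (a, b) & Z (a', b')].
    move=> SX SY Xab Yab; case: (tot X Y SX SY) => sub.
      by exists Y; split=> //; [exact: okS Yab|exact: sub].
    by exists X; split=> //; [exact: okS Xab|exact: sub].
  right; split; last by move=> a b Gab; exists X0 => //; exact: okX0.2.
  split.
  - by move=> a Ba; exists X0 => //; case: okX0 => -[+ _ _ _] _; apply.
  - move=> a b a' b' [X SX Xab] [Y SY Yab].
    have [Z [SZ [[_ + _ _] _] Zab Zab']] := join _ _ _ _ _ _ SX SY Xab Yab.
    by move=> h; exists Z => //; apply: h.
  - move=> a b a' b' [X SX Xab] [Y SY Yab].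
    have [Z [SZ [[_ _ + _] _] Zab Zab']] := join _ _ _ _ _ _ SX SY Xab Yab.
    by move=> h; exists Z => //; apply: h.
  by move=> b [X SX Xb]; case: (okS _ _ _ SX Xb) => -[_ _ _ h] _; apply: h.
have G11 : G 1 1 by case: hG => h _ _ _; apply: h; case: hB.
case: okA => [A0|[homA GA]].
  case: (maxA (fun x => G x.1 x.2)).
    by rewrite A0; split=> // /(_ (1, 1)) /=; apply.
  by right; split.
exists (rel_of A); split=> // t.
have [G' [hG' sub [t' Gtt']]] := extend_hom homA t.
exists t'; apply: contrapT => nA.
apply: (maxA (fun x => G' x.1 x.2)).
  split; first by move=> [a b] Aab; apply: sub.
  by move=> h; apply: nA; exact: (h (t, t')).
by right; split=> // a b Gab; apply: sub; apply: GA.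
Qed.

(** It is injective and permutes the finitely many roots of each polynomial
    over B. *)
Lemma endomorphism_bijective (g : {rmorphism L -> L}) :
  (forall a, B a -> g a = a) -> bijective g.
Proof.
move=> fixg; have injg : injective g := fmorph_inj g.
have surj b : exists a, g a = b.
  have [P [nP hP Pb]] := algB b.
  have [rs rsE] := closed_field_poly_normal P.
  have gP : map_poly g P = P.
    by apply/polyP => k; rewrite coef_map /= fixg.
  have rootE x : root P x = (x \in undup rs).
    by rewrite mem_undup rsE rootZ ?lead_coef_eq0 // root_prod_XsubC.
  have sub : {subset map g (undup rs) <= undup rs}.
    move=> y /mapP [x]; rewrite -!rootE => /rootP Px ->; apply/rootP.
    by rewrite -gP horner_map Px rmorph0.
  have un : uniq (map g (undup rs)) by rewrite map_inj_uniq ?undup_uniq.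
  have [|_ e] := uniq_min_size un sub; first by rewrite size_map.
  have : b \in map g (undup rs) by rewrite e -rootE; apply/rootP.
  by case/mapP => a _ ->; exists a.
have [h hK] := choice surj.
by exists h => // a; apply: injg; rewrite hK.
Qed.

Lemma conjugate_automorphism (z z' : L) (P : {poly L}) : coefs_in B P ->
  P \is monic -> P.[z] = 0 -> P.[z'] = 0 ->
  (forall P', coefs_in B P' -> P'.[z] = 0 -> (size P' < size P)%N -> P' = 0) ->
  exists g : {rmorphism L -> L},
    [/\ bijective g, forall a, B a -> g a = a & g z = z'].
Proof.
move=> hP mP Pz Pz' minP; pose D a b := B a /\ a = b.
have hD : partial_hom D.
  split=> [a Ba|a b a' b' [Ba <-] [Ba' <-]|a b a' b' [Ba <-] [Ba' <-]|b [_ <-]] //.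
    by split=> //; case: hB => _ h _ _; apply: h.
  by split=> //; apply: subfieldM.
have hPP : coefs_rel D P P by move=> k; split.
have hA := adjoin_rel_hom hD hPP mP Pz Pz'.
have [|G [homG sub tot]] := hom_total (hA _).
  by move=> P' Q' hPQ'; apply: minP => k; case: (hPQ' k).
have [f fE] := choice tot.
case: (homG) => hd hS hM _.
have fB : zmod_morphism f.
  by move=> a b; apply: (hom_fun homG (fE _)); apply: hS.
have fM : monoid_morphism f.
  split; first by apply: (hom_fun homG (fE _)); apply: (hd); case: hB.
  by move=> a b; apply: (hom_fun homG (fE _)); apply: (hM).
pose fz := GRing.isZmodMorphism.Build L L f fB.
pose fm := GRing.isMonoidMorphism.Build L L f fM.
pose g : {rmorphism L -> L} := HB.pack f fz fm.
have fixg a : B a -> g a = a by move=> Ba; apply: (hom_fun homG (fE _)); apply: (hd).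
exists g; split=> //; first exact: endomorphism_bijective.
by apply: (hom_fun homG (fE _)); apply: sub; apply: adjoin_rel_gen.
Qed.

End Embeddings.

(** * Coefficients of products of linear factors *)

Lemma coef_1DXn_exp (T : comNzRingType) s n k : (0 < s)%N -> (k <= n)%N ->
  ((1 + 'X^s : {poly T}) ^+ n)`_(s * k) = 'C(n, k)%:R.
Proof.
move=> s0 le; rewrite exprDn coef_sum (bigD1 (Ordinal (le : (k < n.+1)%N))) //=.
rewrite big1 ?addr0 => [|i ni]; rewrite coefMn expr1n mul1r -exprM coefXn.
  by rewrite eqxx.
rewrite eqn_pmul2l //; case: eqP => [e|_]; last by rewrite mul0rn.
by case/eqP: ni; apply: val_inj.
Qed.

(** Modulo p this binomial coefficient is that of X^q in
    (1 + X)^(q m) = (1 + X^q)^m, which is m. *)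
Lemma coprime_bin_pX p a m : prime p -> coprime p m ->
  coprime p 'C(m * p ^ a, p ^ a).
Proof.
move=> p_pr cop; have chp := pchar_Fp p_pr.
have q0 : (0 < p ^ a)%N by rewrite expn_gt0 prime_gt0.
have m0 : (0 < m)%N.
  by case: m cop => //; rewrite /coprime gcdn0 => /eqP p1; move: p_pr; rewrite p1.
suff e : ('C(m * p ^ a, p ^ a))%:R = m%:R :> 'F_p.
  by rewrite prime_coprime // (dvdn_pcharf chp) e -(dvdn_pcharf chp) -prime_coprime.
rewrite -[in RHS](bin1 m) -(coef_1DXn_exp _ q0 m0) muln1.
rewrite -(@coef_1DXn_exp _ 1) //; last by rewrite leq_pmull.
rewrite mul1n expr1 mulnC exprM exprDn_pchar ?expr1n //.
have chP : p \in [pchar {poly 'F_p}] by rewrite pchar_poly.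
by rewrite pnatX pnatE //; apply/orP; left.
Qed.

Section Valuation.
Variables (R : realType) (L : fieldType) (v : L -> \bar R).
Hypothesis hv : is_valuation v.
Variable p : nat.
Hypotheses (p_pr : prime p) (vp : vge v 1 p%:R).

Lemma vr_coprime n : coprime p n -> (n%:R : L) != 0 /\ vr v n%:R = 0.
Proof.
move=> cop; have n0 : (0 < n)%N.
  by case: n cop => //; rewrite /coprime gcdn0 => /eqP p1; move: p_pr; rewrite p1.
case: (egcdnP p n0) => a b e _; move: e; rewrite gcdnC (eqP cop) addn1 => e.
have eL : a%:R * n%:R = 1 + (b * p)%:R :> L by rewrite -natrM e mulrSr addrC.
have lt01 : vr v 1 < 1 by rewrite (vr1 hv) ltr01.
have hb : vge v 1 (b * p)%:R by apply/(vge_dvdn hv vp)/dvdn_mull.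
have [nz e0] := vr_gap hv (oner_neq0 L) hb lt01.
move: nz e0; rewrite -eL mulf_eq0 negb_or => /andP [na nn]; split=> //.
move: e0; rewrite vrM // vr1 //.
have /(vgeE hv _ na) := vge_nat hv a; have /(vgeE hv _ nn) := vge_nat hv n.
lra.
Qed.

(** The Gauss valuation of P is at least r. *)
Definition vgep (r : R) (P : {poly L}) : Prop := forall k, vge v r P`_k.

Lemma vgepD r P Q : vgep r P -> vgep r Q -> vgep r (P + Q).
Proof. by move=> hP hQ k; rewrite coefD; apply: vgeD. Qed.

Lemma vgepM r s P Q : vgep r P -> vgep s Q -> vgep (r + s) (P * Q).
Proof. by move=> hP hQ k; rewrite coefM; apply: vge_sum => // i _; apply: vgeM. Qed.

Lemma vgepC r a : vge v r a -> vgep r a%:P.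
Proof. by move=> h k; rewrite coefC; case: eqP => // _; exact: vge0. Qed.

Lemma vgep_XsubC a : vge v 0 a -> vgep 0 ('X - a%:P).
Proof.
move=> h k; rewrite coefB coefX coefC; apply: (vgeB hv).
  exact: vge_nat.
by case: eqP => // _; exact: vge0.
Qed.

Lemma vgepX P n : vgep 0 P -> vgep 0 (P ^+ n).
Proof.
move=> h; elim: n => [|n IH]; first by rewrite expr0; apply: vgepC; exact: vge1.
by rewrite exprS -[0](addr0 0); apply: vgepM.
Qed.

Lemma prod_XsubC_cong (r : R) (s : seq L) z : vge v 0 z ->
  (forall t, t \in s -> vge v 0 t /\ vge v r (t - z)) ->
  vgep r (\prod_(t <- s) ('X - t%:P) - ('X - z%:P) ^+ size s).
Proof.
move=> hz; elim: s => [|t s IH] h.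
  by rewrite big_nil expr0 subrr -polyC0; apply: vgepC; exact: vge0.
have [ht htz] := h t (mem_head _ _).
rewrite big_cons /= exprS.
rewrite [X in vgep _ X](_ : _ = ('X - t%:P) *
    (\prod_(t <- s) ('X - t%:P) - ('X - z%:P) ^+ size s)
  + (z - t)%:P * ('X - z%:P) ^+ size s); last by rewrite polyCB; ring.
apply: vgepD.
  rewrite -[r]add0r; apply: vgepM; first exact: vgep_XsubC.
  by apply: IH => x xs; apply: h; rewrite inE xs orbT.
rewrite -[r]addr0; apply: vgepM; first by apply: vgepC; apply: vgeC.
by apply: vgepX => //; apply: vgep_XsubC.
Qed.

Lemma coef_XsubC_exp (z : L) n q : (q <= n)%N ->
  (('X - z%:P) ^+ n)`_(n - q) = 'C(n, q)%:R * (- z) ^+ q.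
Proof.
move=> le; rewrite exprDn coef_sum (bigD1 (Ordinal (le : (q < n.+1)%N))) //= big1.
  rewrite addr0 coefMn -polyCN -polyC_exp coefMC coefXn eqxx mul1r.
  by rewrite mulr_natl.
move=> i ni; rewrite coefMn -polyCN -polyC_exp coefMC coefXn.
case: eqP => [e|_]; last by rewrite mul0r mul0rn.
case/eqP: ni; apply: val_inj => /=.
by rewrite -(subKn le) e subKn // -ltnS.
Qed.

End Valuation.

(** * Approximation over a deeply ramified field *)
Section Approximation.
Variables (R : realType) (L : closedFieldType) (v : L -> \bar R).
Hypothesis hv : is_valuation v.
Variable p : nat.
Hypotheses (p_pr : prime p) (vp : vge v 1 p%:R).
Variable M : L -> Prop.
Hypotheses (hM : subfield_pred M) (algM : algebraic_pred M).
Hypothesis frobM : forall b, M b -> vge v 0 b ->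
  exists d, [/\ M d, vge v 0 d & vge v 1 (b - d ^+ p)].
Hypothesis denseM : forall B tau : R, 0 < tau ->
  exists l, [/\ M l, l != 0, B - tau <= vr v l & vr v l <= B].

Lemma frobM_iter a b : M b -> vge v 0 b ->
  exists d, [/\ M d, vge v 0 d & vge v 1 (b - d ^+ (p ^ a))].
Proof.
move=> Mb b0; elim: a => [|a [d [Md d0 hd]]].
  by exists b; rewrite expn0 expr1 subrr; split=> //; exact: vge0.
have [d' [Md' d'0 hd']] := frobM Md d0.
exists d'; split=> //; apply: (vge_trans hv hd).
by rewrite expnS exprM; apply: vge_congX => //; apply: vgeX0.
Qed.

Variables (z : L) (A : R).
Hypothesis conjz : forall g : {rmorphism L -> L}, bijective g ->
  (forall a, M a -> g a = a) -> vge v A (g z - z).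

Lemma prod_XsubC_comp (s : seq L) (l y : L) : l != 0 ->
  (\prod_(t <- s) ('X - t%:P)) \Po (l%:P * 'X + y%:P)
  = (l ^+ size s)%:P * \prod_(t <- s) ('X - ((t - y) / l)%:P).
Proof.
move=> nl; elim: s => [|t s IH]; first by rewrite !big_nil comp_polyC mulr1.
rewrite !big_cons comp_polyM IH /= exprS !polyCM.
have -> : ('X - t%:P) \Po (l%:P * 'X + y%:P) = l%:P * ('X - ((t - y) / l)%:P).
  rewrite comp_polyB comp_polyX comp_polyC mulrBr -polyCM mulrC [l * _]mulrC.
  by rewrite divfK // polyCB; ring.
by ring.
Qed.

(** Rescale z - y by some l in M to an integral z'.  The n conjugates t of z' are
    close to z', so the product of the X - t, whose coefficients lie in M, is
    close to (X - z')^n.  With q the exact power of p dividing n, the binomial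
    coefficient of n and q is a unit, so the coefficient of degree n - q shows
    that z'^q is close to an element of M, hence to d^q for some d in M.  As q is
    a power of p, then z' is close to d. *)
Lemma improve eps : 0 < eps -> exists2 tau : R, 0 < tau &
  forall B y, B <= A - eps -> M y -> vge v B (z - y) ->
  exists2 y', M y' & vge v (B + tau) (z - y').
Proof.
move=> eps0.
have [f0 [[nf0 hf0 f0z] minf0]] := min_size_poly (algM z).
pose f := (lead_coef f0)^-1%:P * f0.
have nl0 : lead_coef f0 != 0 by rewrite lead_coef_eq0.
have hf : coefs_in M f.
  apply: coefs_in_mul => //; apply: coefs_in_C => //.
  by case: hM => _ _ _; apply; apply: hf0.
have mf : f \is monic by rewrite monicE lead_coefM lead_coefC mulVf.
have fz : f.[z] = 0 by rewrite hornerM f0z mulr0.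
have minf P' : coefs_in M P' -> P'.[z] = 0 -> (size P' < size f)%N -> P' = 0.
  move=> hP' P'z; rewrite size_Cmul ?invr_eq0 // ltnNge => h.
  by apply/eqP/negPn/negP => nP'; move/negP: h; apply; apply: minf0.
have [rs] := closed_field_poly_normal f; rewrite (monicP mf) scale1r => rsE.
pose n := size rs.
have n0 : (0 < n)%N.
  rewrite lt0n; apply/eqP => /size0nil rs0; move: fz.
  by rewrite rsE rs0 big_nil hornerC => /eqP; rewrite oner_eq0.
have conj t : t \in rs -> vge v A (t - z).
  move=> trs; have [|g [bg fixg <-]] := conjugate_automorphism hM algM (z' := t) hf mf fz _ minf.
    by apply/rootP; rewrite rsE root_prod_XsubC.
  exact: conjz.
pose al := Num.min eps 1; have al0 : 0 < al by rewrite lt_min eps0 ltr01.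
have al1 : al <= 1 by rewrite ge_min lexx orbT.
have ale : al <= eps by rewrite ge_min lexx.
have nR : 0 < n%:R :> R by rewrite ltr0n.
(* As q <= n, one half of al / q is left when v(l) differs from B by tau. *)
exists (al / (2 * n%:R)); first by rewrite divr_gt0 // mulr_gt0.
set tau := al / _ => B y leB My hy.
have tau0 : 0 < tau by rewrite divr_gt0 // mulr_gt0.
have [l [Ml nl l1 l2]] := denseM B tau0.
pose sc t := (t - y) / l; pose z' := sc z.
have scK t : sc t * l = t - y by rewrite divfK.
have hz' : vge v 0 z'.
  by apply: (vgeMI hv nl); rewrite scK add0r; apply: vgeW hy.
have hs t : t \in map sc rs -> vge v 0 t /\ vge v al (t - z').
  case/mapP => t0 t0rs ->.
  have h : vge v al (sc t0 - z').
    apply: (vgeMI hv nl); rewrite mulrBl !scK opprB addrA subrK.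
    by apply: vgeW (conj t0 t0rs); lra.
  split=> //; rewrite -(subrK z' (sc t0)); apply: (vgeD hv) => //.
  by apply: vgeW h; exact: ltW.
have := prod_XsubC_cong hv hz' hs; rewrite big_map size_map -/n.
set f' := \prod_(t <- rs) _ => cong.
have hf' : coefs_in M f'.
  have -> : f' = (l ^- n)%:P * (f \Po (l%:P * 'X + y%:P)).
    by rewrite rsE prod_XsubC_comp // mulrA -polyCM mulVf ?expf_neq0 // mul1r.
  apply: coefs_in_mul => //.
    by apply: coefs_in_C => //; case: hM => _ _ _; apply; apply: subfieldX.
  apply: coefs_in_comp => // k; rewrite coefD coefCM coefX coefC.
  apply: subfieldD => //; last by case: eqP => // _; exact: subfield0.
  by apply: subfieldM => //; apply: subfield_nat.
have [m copm nE] := pfactor_coprime p_pr n0.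
set a := logn p n in nE; pose q := (p ^ a)%N.
have q0 : (0 < q)%N by rewrite expn_gt0 prime_gt0.
have qn : (q <= n)%N.
  by rewrite nE leq_pmull // lt0n; apply: contraTneq n0 => m0; rewrite nE m0.
have [nC vC] : 'C(n, q)%:R != 0 :> L /\ vr v 'C(n, q)%:R = 0.
  by apply: (vr_coprime hv p_pr vp); rewrite nE; apply: coprime_bin_pX.
have := cong (n - q)%N; rewrite coefB coef_XsubC_exp // => hb.
pose s := (-1) ^+ q / 'C(n, q)%:R : L; pose b := s * f'`_(n - q).
have ns : s != 0 by rewrite mulf_neq0 ?invr_eq0 // signr_eq0.
have vs : vge v 0 s.
  apply/(vgeE hv _ ns); rewrite vrM ?invr_eq0 ?signr_eq0 // vrV // vC subr0.
  by rewrite vrX ?oppr_eq0 ?oner_eq0 // vrN // vr1 // mul0rn.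
have hbz : vge v al (b - z' ^+ q).
  have -> : b - z' ^+ q = s * (f'`_(n - q) - 'C(n, q)%:R * (- z') ^+ q).
    rewrite mulrBr -/b /s; congr (_ - _).
    rewrite mulrA divfK // -exprMn mulrN mulNr opprK mul1r //.
  by apply: (vgeMl hv).
have Mb : M b.
  apply: subfieldM => //; apply: subfieldM => //; last first.
    by case: hM => _ _ _; apply; apply: subfield_nat.
  by apply: subfieldX => //; apply: subfieldN => //; case: hM.
have b0 : vge v 0 b.
  rewrite -(subrK (z' ^+ q) b); apply: (vgeD hv); last exact: vgeX0.
  by apply: vgeW hbz; exact: ltW.
have [d [Md d0 hd]] := frobM_iter a Mb b0.
have hzd : vge v al ((z' - d) ^+ q).
  have h0 : vge v 0 (z' - d) by apply: vgeB.
  have := vge_frobDX hv p_pr vp a h0 d0; rewrite subrK -/q => h1.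
  rewrite [X in vge v _ X](_ : _ = - (z' ^+ q - ((z' - d) ^+ q + d ^+ q))
     + ((z' ^+ q - b) + (b - d ^+ q))); last by ring.
  apply: (vgeD hv); first by apply/(vgeN hv); apply: vgeW h1.
  by apply: (vgeD hv); [exact: vgeC|exact: vgeW hd].
have := vge_root hv q0 hzd => h.
exists (y + d * l); first by apply: subfieldD => //; apply: subfieldM.
have -> : z - (y + d * l) = (z' - d) * l by rewrite mulrBl scK; ring.
apply: vgeW (vgeM hv h (vge_vr hv l)).
have : 2 * tau <= al / q%:R.
  have -> : 2 * tau = al / n%:R by rewrite /tau invfM; field; rewrite gt_eqF.
  by rewrite ler_pM2l // lef_pV2 ?posrE ?ltr0n // ler_nat.
lra.
Qed.

(** The gain tau of [improve] does not depend on the approximation to be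
    improved, so finitely many steps suffice. *)
Lemma approximation eps : 0 < eps -> exists2 y, M y & vge v (A - eps) (z - y).
Proof.
move=> eps0; have [tau tau0 step] := improve eps0.
have iter (k : nat) : exists2 y, M y &
    vge v (Num.min (vr v z + k%:R * tau) (A - eps)) (z - y).
  elim: k => [|k [y My hy]].
    exists 0; first exact: subfield0.
    by rewrite subr0; apply: vgeW (vge_vr hv z); rewrite ge_min mul0r addr0 lexx.
  have [|y' My' hy'] := step _ _ _ My hy; first by rewrite ge_min lexx orbT.
  exists y' => //; apply: vgeW hy'; set x := vr v z; set c := A - eps.
  rewrite -addn1 natrD mulrDl mul1r.
  have [le|lt] := leP (x + k%:R * tau) c; rewrite ge_min; apply/orP; [left|right]; lra.
pose N := Num.bound `|(A - eps - vr v z) / tau|.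
have [y My hy] := iter N; exists y => //; apply: vgeW hy.
rewrite le_min lexx andbT -lerBlDl -ler_pdivrMr //.
exact: ltW (le_lt_trans (ler_norm _) (archi_boundP (normr_ge0 _))).
Qed.

End Approximation.

(** * Roots of unity of order a power of p *)
Section RootsOfUnity.
Variables (R : realType) (L : closedFieldType) (v : L -> \bar R).
Hypothesis hv : is_valuation v.
Variable p : nat.
Hypotheses (p_pr : prime p) (vp1 : vr v p%:R = 1) (p_neq0 : (p%:R : L) != 0).

Let vp : vge v 1 p%:R. Proof. by apply/(vgeE hv); rewrite ?vp1. Qed.
Let p1_gt0 : 0 < p%:R - 1 :> R.
Proof. by rewrite subr_gt0 ltr1n prime_gt1. Qed.

(** The binomial coefficients strictly between the ends are divisible by p. *)
Lemma expand_1Dt t : vge v 0 t -> exists2 r, vge v 0 r &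
  (1 + t) ^+ p - 1 = t ^+ p + p%:R * t * (1 + t * r).
Proof.
move=> ht; have [q pq] : exists q, p = q.+2.
  by exists p.-2; case: (p) (prime_gt1 p_pr) => [|[|]].
exists (\sum_(i < q) ('C(p, i.+2) %/ p)%:R * t ^+ i).
  by apply: vge_sum => // i _; apply: (vgeMl hv); [exact: vge_nat|exact: vgeX0].
have -> : (1 + t) ^+ p = 1 + p%:R * t + \sum_(i < q) (t ^+ i.+2 *+ 'C(p, i.+2)) + t ^+ p.
  rewrite pq exprDn big_ord_recr !big_ord_recl /= !expr1n.
  under [in LHS]eq_bigr do rewrite expr1n mul1r /bump /= add1n.
  rewrite !expr0 !mul1r binn bin0 /bump /= addn0 bin1 expr1 !mulr1n.
  by rewrite -mulr_natl; ring.
have -> : \sum_(i < q) (t ^+ i.+2 *+ 'C(p, i.+2))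
    = p%:R * t * (t * \sum_(i < q) ('C(p, i.+2) %/ p)%:R * t ^+ i).
  rewrite !mulr_sumr; apply: eq_bigr => i _.
  have dv : (p %| 'C(p, i.+2))%N.
    by apply: prime_dvd_bin => //; rewrite /= [X in (_ < X)%N]pq !ltnS ltn_ord.
  by rewrite -{1}(divnK dv) -mulr_natr natrM !exprS; ring.
by ring.
Qed.

Lemma vge_root_unity z n : (0 < n)%N -> z ^+ n = 1 -> vge v 0 z.
Proof.
by move=> n0 e; rewrite -(mul0r n%:R^-1); apply: (vge_root hv) => //; rewrite e; exact: vge1.
Qed.

Let pR0 : 0 < p%:R :> R. Proof. by rewrite ltr0n prime_gt0. Qed.

Lemma frob_1Dt_pos r t : vge v 0 t -> t != 0 -> 0 < r ->
  vge v r ((1 + t) ^+ p - 1) -> 0 < vr v t.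
Proof.
move=> ht nt r0 hs; have [x hx E] := expand_1Dt ht.
have : vge v (Num.min r 1) (t ^+ p).
  have -> : t ^+ p = ((1 + t) ^+ p - 1) - p%:R * t * (1 + t * x) by rewrite E; ring.
  apply: (vgeB hv); first by apply: vgeW hs; rewrite ge_min lexx.
  apply: (vgeMr hv); last by apply: (vgeD hv); [exact: vge1|exact: (vgeMl hv)].
  by apply: (vgeMr hv) => //; apply: vgeW vp; rewrite ge_min lexx orbT.
move/(vge_root hv (prime_gt0 p_pr))/(vgeE hv _ nt); apply: lt_le_trans.
by rewrite divr_gt0 // lt_min r0 ltr01.
Qed.

Lemma frob_1Dt t : t != 0 -> 0 < vr v t -> exists u,
  [/\ u != 0, vr v u = 1 + vr v t & (1 + t) ^+ p - 1 = t ^+ p + u].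
Proof.
move=> nt t0.
have ht : vge v 0 t by apply/(vgeE hv _ nt); exact: ltW.
have [x hx E] := expand_1Dt ht; exists (p%:R * t * (1 + t * x)).
have lt1 : vr v 1 < vr v t by rewrite vr1.
have [n1 e1] := vr_gap hv (oner_neq0 L) (vgeMr hv (vge_vr hv t) hx) lt1.
by rewrite !mulf_neq0 // !vrM ?mulf_neq0 // vp1 e1 vr1 // addr0.
Qed.

(** With t = z - 1 the equation (1 + t)^p = 1 + s reads t^p + p t (unit) = s.
    For s = 0 this gives v(t) = 1/(p-1); for 0 < v(s) < p/(p-1) the first term
    has to dominate, so v(t) = v(s)/p. *)
Lemma vr_prim_root n z : z ^+ (p ^ n.+1) = 1 -> z ^+ (p ^ n) != 1 ->
  vr v (z - 1) = (p%:R ^+ n * (p%:R - 1))^-1.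
Proof.
elim: n z => [|n IH] z e1 e2; set t := z - 1.
  have zt : z = 1 + t by rewrite /t addrC subrK.
  have ht : vge v 0 t.
    apply: (vgeB hv); last exact: vge1.
    by apply: vge_root_unity e1; rewrite expn_gt0 prime_gt0.
  have nt : t != 0 by apply: contraNneq e2; rewrite expn0 expr1 zt => ->; rewrite addr0.
  have s0 : (1 + t) ^+ p - 1 = 0 by rewrite -zt -{1}[p]expn1 e1 subrr.
  have t0 : 0 < vr v t.
    by apply: (@frob_1Dt_pos 1) => //; rewrite s0; exact: vge0.
  have [u [nu eu]] := frob_1Dt nt t0; rewrite s0 => /esym E.
  have Eu : t ^+ p = - u by apply/eqP; rewrite -addr_eq0 E.
  have := congr1 (vr v) Eu; rewrite vrX // vrN // eu -(mulr_natl (vr v t)) => e4.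
  have e5 : vr v t * (p%:R - 1) = 1 by lra.
  rewrite expr0 mul1r; apply: (mulIf (lt0r_neq0 p1_gt0)).
  by rewrite e5 mulVf // lt0r_neq0.
have zt : z = 1 + t by rewrite /t addrC subrK.
have ht : vge v 0 t.
  apply: (vgeB hv); last exact: vge1.
  by apply: vge_root_unity e1; rewrite expn_gt0 prime_gt0.
have nt : t != 0 by apply: contraNneq e2; rewrite zt => ->; rewrite addr0 expr1n.
pose s := z ^+ p - 1.
have vs : vr v s = (p%:R ^+ n * (p%:R - 1))^-1.
  by apply: IH; rewrite -exprM -expnS.
have ns : s != 0.
  apply: contraNneq e2 => /eqP; rewrite /s subr_eq0 => /eqP zp.
  by rewrite expnS exprM zp expr1n.
have pn0 : 0 < p%:R ^+ n :> R by rewrite exprn_gt0.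
have vs0 : 0 < vr v s by rewrite vs invr_gt0 mulr_gt0.
have vs1 : vr v s * (p%:R - 1) <= 1.
  rewrite vs invfM -mulrA mulVf ?lt0r_neq0 // mulr1 invf_le1 //.
  by rewrite exprn_ege1 // ler1n prime_gt0.
have t0 : 0 < vr v t.
  by apply: (frob_1Dt_pos ht nt vs0); rewrite -zt; exact: vge_vr.
have [u [nu eu E]] := frob_1Dt nt t0.
have sE : s = t ^+ p + u by rewrite -E -zt.
have vtp : vr v (t ^+ p) = p%:R * vr v t by rewrite vrX // mulr_natl.
have [lt|le] := ltP (p%:R * vr v t) (1 + vr v t).
  have [] := vr_gap hv (expf_neq0 p nt) (vge_vr hv u).
    by rewrite vtp eu.
  rewrite -sE vtp vs => _ e3; apply: (mulfI (lt0r_neq0 pR0)).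
  by rewrite -e3 exprS !invfM !mulrA divff ?mul1r // lt0r_neq0.
exfalso; have : vge v (1 + vr v t) s.
  rewrite sE; apply: (vgeD hv); last by rewrite -eu; exact: vge_vr.
  by apply: vgeW le _; rewrite -vtp; exact: vge_vr.
move/(vgeE hv _ ns) => h.
have : 1 <= (p%:R - 1) * vr v t by lra.
have p1 := p1_gt0; nra.
Qed.

Lemma vge_root_unity_sub1 n z : z ^+ (p ^ n.+1) = 1 ->
  vge v ((p%:R ^+ n * (p%:R - 1))^-1) (z - 1).
Proof.
elim: n z => [|n IH] z e1.
  have [z1|ne] := eqVneq z 1; first by rewrite z1 subrr; exact: vge0.
  by rewrite -(@vr_prim_root 0 z) // ?expn0 ?expr1 //; exact: vge_vr.
have [e2|ne] := eqVneq (z ^+ (p ^ n.+1)) 1; last first.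
  by rewrite -(vr_prim_root e1 ne); exact: vge_vr.
apply: vgeW (IH z e2); have pn0 : 0 < p%:R ^+ n :> R by rewrite exprn_gt0.
rewrite lef_pV2 ?posrE ?mulr_gt0 ?exprn_gt0 //.
by rewrite ler_pM2r // exprS ler_peMl ?ltW // ltr1n prime_gt1.
Qed.

(** Starting from a root of 1 + X + ... + X^(p-1), extract p-th roots. *)
Lemma prim_root_exists n : exists z : L, z ^+ (p ^ n.+1) = 1 /\ z ^+ (p ^ n) != 1.
Proof.
elim: n => [|n [z [e1 e2]]].
  have p1 : (0 < p.-1)%N by rewrite -subn1 subn_gt0 prime_gt1.
  have [z e] := solve_monicpoly (fun=> -1 : L) p1.
  have zS : \sum_(i < p) z ^+ i = 0.
    have -> : p = p.-1.+1 by rewrite prednK ?prime_gt0.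
    rewrite big_ord_recr /= e.
    by rewrite -big_split big1 //= => i _; rewrite mulN1r subrr.
  exists z; rewrite expn1 expn0 expr1; split.
    by apply/eqP; rewrite -subr_eq0 subrX1 zS mulr0.
  apply/eqP => z1; move: zS; rewrite z1 => /eqP.
  under eq_bigr do rewrite expr1n.
  by rewrite sumr_const card_ord (negPf p_neq0).
have [y e] := solve_monicpoly (fun i => if i == 0%N then z else 0 : L) (prime_gt0 p_pr).
have yz : y ^+ p = z.
  have pq : p = p.-1.+1 by rewrite prednK ?prime_gt0.
  rewrite e pq big_ord_recl /= expr0 mulr1.
  by rewrite big1 ?addr0 // => i _; rewrite /= mul0r.
by exists y; rewrite !(expnS p) !exprM yz -!exprM -!expnS.
Qed.

(** The order of z^n is the order p^(N+1) of z divided by the exact power of p in n. *)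
Lemma vr_prim_root_exp N z n : z ^+ (p ^ N.+1) = 1 -> z ^+ (p ^ N) != 1 ->
  (0 < n)%N -> (logn p n <= N)%N ->
  z ^+ n - 1 != 0 /\
  vr v (z ^+ n - 1) = (p%:R ^+ (N - logn p n) * (p%:R - 1))^-1.
Proof.
move=> e1 e2 n0 leN; have [m copm nE] := pfactor_coprime p_pr n0.
set l := logn p n in nE leN *.
have ne : z ^+ n ^+ (p ^ (N - l)) != 1.
  rewrite -exprM nE -mulnA -expnD subnKC // mulnC exprM.
  set w := z ^+ (p ^ N) in e2 *; apply: contraNneq e2 => wm.
  have wp : w ^+ p = 1 by rewrite /w -exprM -expnSr.
  have m0 : (0 < m)%N by rewrite lt0n; apply: contraTneq n0 => m0; rewrite nE m0.
  case: (egcdnP p m0) => a b eab _; move: eab; rewrite gcdnC (eqP copm) addn1 => eab.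
  by have := congr1 (fun i => w ^+ i) eab; rewrite mulnC exprM wm expr1n exprS mulnC exprM wp expr1n mulr1 => /esym/eqP.
have e3 : z ^+ n ^+ (p ^ (N - l).+1) = 1.
  by rewrite -exprM nE -mulnA -expnD addnS subnKC // mulnC exprM e1 expr1n.
split; last exact: vr_prim_root.
by rewrite subr_eq0; apply: contraNneq ne => ->; rewrite expr1n.
Qed.

End RootsOfUnity.

(** * Expansions in the tower *)
Section Arithmetic.

Lemma mod_expansion_inj (E n n' : nat) (z z' : int) :
  (n < E)%N -> (n' < E)%N -> z * E%:Z + n%:Z = z' * E%:Z + n'%:Z -> n = n'.
Proof.
move=> lt lt' e; have := congr1 (fun i => (i %% E%:Z)%Z) e.
by rewrite /= !modzMDl !modz_small ?ltz_nat // => -[].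
Qed.

(** For l = logn p n < logn p n', all terms of the equation other than (p - 1) n
    would be divisible by p^(l+1), hence n as well. *)
Lemma twisted_logn_le (p e N n n' : nat) (z z' : int) : prime p ->
  (0 < n)%N -> (0 < n')%N -> (logn p n < N)%N ->
  (p%:Z - 1) * (z * (e * p ^ N)%N%:Z + n%:Z) + e%:Z * (p ^ (logn p n).+1)%N%:Z =
  (p%:Z - 1) * (z' * (e * p ^ N)%N%:Z + n'%:Z) + e%:Z * (p ^ (logn p n').+1)%N%:Z ->
  (logn p n' <= logn p n)%N.
Proof.
move=> p_pr n0 n'0 lN eq; rewrite leqNgt; apply/negP => lt.
set l := logn p n in lN eq lt; set l' := logn p n' in eq lt.
have dN : (p ^ l.+1 %| p ^ N)%N by apply: dvdn_exp2l.
have d' : (p ^ l.+1 %| p ^ l'.+1)%N by apply: dvdn_exp2l; exact: ltnW.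
have dn' : (p ^ l.+1 %| n')%N by rewrite pfactor_dvdn.
case/dvdnP: dN => a aE; case/dvdnP: d' => b bE; case/dvdnP: dn' => c cE.
have : ((p ^ l.+1)%N%:Z %| (p.-1 * n)%N%:Z)%Z.
  apply/dvdzP; exists ((p%:Z - 1) * ((z' - z) * e%:Z * a%:Z + c%:Z) + e%:Z * b%:Z - e%:Z).
  have p1 : (p.-1)%:Z = p%:Z - 1 by have := prime_gt0 p_pr; lia.
  move: eq; rewrite aE bE cE !PoszM p1 => eq.
  pose Q := (p ^ l.+1)%N%:Z; rewrite -/Q in eq *.
  have -> : (p%:Z - 1) * n%:Z = ((p%:Z - 1) * (z * (e%:Z * (a%:Z * Q)) + n%:Z) + e%:Z * Q)
      - (p%:Z - 1) * (z * (e%:Z * (a%:Z * Q))) - e%:Z * Q by ring.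
  by rewrite eq; ring.
rewrite dvdzE /= Gauss_dvdr; last first.
  by rewrite coprimeXl // coprime_sym -{2}(prednK (prime_gt0 p_pr)) coprimenS.
by rewrite pfactor_dvdn // ltnn.
Qed.

End Arithmetic.

Section Tower.
Variables (R : realType) (F : fieldType) (L : closedFieldType).
Variables (phi : {rmorphism F -> L}) (v : L -> \bar R) (p e : nat).
Variables (rho : nat -> L).

(** F has value group Z and p-th roots modulo p; rho_0 has the valuation of a
    uniformizer of a totally ramified extension of F of degree e, and the other
    rho_m are its successive p-th roots. *)
Record kummer_tower : Prop := KummerTower {
  tower_valuation : is_valuation v;
  tower_prime : prime p;
  tower_vp : vr v p%:R = 1;
  tower_p_neq0 : (p%:R : L) != 0;
  tower_int : forall a, a != 0 -> exists z : int, vr v (phi a) = z%:~R;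
  tower_frob : forall a, vge v 0 (phi a) ->
    exists2 b, vge v 0 (phi b) & vge v 1 (phi (a - b ^+ p));
  tower_algebraic : forall z, algebraicOver phi z;
  tower_e_gt0 : (0 < e)%N;
  tower_rho0_neq0 : rho 0%N != 0;
  tower_v_rho0 : vr v (rho 0%N) = e%:R^-1;
  tower_rhoS : forall m, rho m.+1 ^+ p = rho m }.

Hypothesis T : kummer_tower.

Let hv : is_valuation v := tower_valuation T.
Let p_pr : prime p := tower_prime T.
Let vp1 : vr v p%:R = 1 := tower_vp T.
Let p_neq0 : (p%:R : L) != 0 := tower_p_neq0 T.
Let vF := tower_int T.
Let frobF := tower_frob T.
Let algF := tower_algebraic T.
Let e_gt0 : (0 < e)%N := tower_e_gt0 T.
Let rho0_neq0 : rho 0%N != 0 := tower_rho0_neq0 T.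
Let v_rho0 : vr v (rho 0%N) = e%:R^-1 := tower_v_rho0 T.
Let rhoS : forall m, rho m.+1 ^+ p = rho m := tower_rhoS T.

Let vp : vge v 1 p%:R. Proof. by apply/(vgeE hv); rewrite ?vp1. Qed.
Let pR0 : 0 < p%:R :> R. Proof. by rewrite ltr0n prime_gt0. Qed.
Let p_gt0 : (0 < p)%N. Proof. exact: prime_gt0. Qed.

Definition rdeg m : nat := (e * p ^ m)%N.

Lemma rdeg_gt0 m : (0 < rdeg m)%N.
Proof. by rewrite muln_gt0 e_gt0 expn_gt0 p_gt0. Qed.

Let rdegR m : 0 < (rdeg m)%:R :> R. Proof. by rewrite ltr0n rdeg_gt0. Qed.

Lemma rho_exp m d : rho (d + m)%N ^+ (p ^ d) = rho m.
Proof.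
elim: d => [|d IH]; first by rewrite expn0 expr1.
by rewrite expnS exprM addSn rhoS.
Qed.

Lemma rho_exp0 m : rho m ^+ (p ^ m) = rho 0.
Proof. by rewrite -(rho_exp 0 m) addn0. Qed.

Lemma rho_neq0 m : rho m != 0.
Proof.
apply: contraNneq rho0_neq0 => h.
by rewrite -(rho_exp0 m) h expr0n expn_eq0 (gtn_eqF p_gt0).
Qed.

Lemma vr_rho m : vr v (rho m) = (rdeg m)%:R^-1.
Proof.
have := congr1 (vr v) (rho_exp0 m); rewrite vrX ?rho_neq0 // v_rho0 => h.
have q0 : 0 < (p ^ m)%:R :> R by rewrite ltr0n expn_gt0 p_gt0.
apply: (mulIf (lt0r_neq0 q0)); rewrite mulr_natr h /rdeg natrM invfM.
by rewrite mulfVK // lt0r_neq0.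
Qed.

Definition expansion m (f : nat -> F) : L :=
  \sum_(n < rdeg m) phi (f n) * rho m ^+ n.

Lemma term_neq0 m a n : (phi a * rho m ^+ n != 0) = (a != 0).
Proof. by rewrite mulf_eq0 expf_eq0 (negPf (rho_neq0 m)) andbF orbF fmorph_eq0. Qed.

Lemma vr_term m a n : a != 0 -> exists z : int,
  vr v (phi a * rho m ^+ n) = (z * (rdeg m)%:Z + n%:Z)%:~R / (rdeg m)%:R.
Proof.
move=> na; have [z ez] := vF na; exists z.
rewrite vrM ?fmorph_eq0 ?expf_neq0 ?rho_neq0 // vrX ?rho_neq0 // vr_rho ez.
rewrite rmorphD rmorphM /= -!pmulrn -(mulr_natl (_^-1) n) mulrDl mulfK //.
by rewrite lt0r_neq0.
Qed.

Lemma expansion_distinct m (f : nat -> F) (i k : 'I_(rdeg m)) : i != k ->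
  phi (f i) * rho m ^+ i != 0 -> phi (f k) * rho m ^+ k != 0 ->
  vr v (phi (f i) * rho m ^+ i) != vr v (phi (f k) * rho m ^+ k).
Proof.
rewrite !term_neq0 => ik ni nk; have [z ->] := vr_term m i ni.
have [z' ->] := vr_term m k nk; apply: contra_neq ik => h.
apply: val_inj; apply: (@mod_expansion_inj (rdeg m) i k z z') => //.
have nE : ((rdeg m)%:R : R)^-1 != 0 by rewrite invr_eq0 lt0r_neq0.
by apply/eqP; rewrite -(eqr_int R); apply/eqP; exact: (mulIf nE).
Qed.

Lemma vge_expansion r m f : vge v r (expansion m f) ->
  forall n, (n < rdeg m)%N -> vge v r (phi (f n) * rho m ^+ n).
Proof.
move=> h n lt.
exact: (vge_sum_distinct hv (@expansion_distinct m f) h (Ordinal lt)).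
Qed.

Lemma expansion_eq0 m f : expansion m f = 0 ->
  forall n, (n < rdeg m)%N -> f n = 0.
Proof.
move=> h n lt; apply/eqP/negPn/negP; rewrite -(term_neq0 m _ n) => /eqP; apply.
apply: (vge_eq0 hv) => k; apply: vge_expansion lt; rewrite h; exact: vge0.
Qed.

Lemma vr_expansion m f : expansion m f != 0 ->
  exists z : int, vr v (expansion m f) = z%:~R / (rdeg m)%:R.
Proof.
move=> nz; case: (vr_sum_distinct hv (@expansion_distinct m f)) => [h|].
  by case/eqP: nz; rewrite /expansion big1.
case=> i [ni _ eS _]; rewrite term_neq0 in ni.
by have [z ez] := vr_term m i ni; exists (z * (rdeg m)%:Z + i%:Z); rewrite -ez.
Qed.

(** F(rho_m), described as F[rho_m]; it is a field by [subfield_Kfield]. *)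
Definition Kfield m (y : L) : Prop := exists P : {poly F}, y = (map_poly phi P).[rho m].

(* With [expansion_eq0], this says that F(rho_0) has degree e over F. *)
Variable g : {poly F}.
Hypotheses (size_g : size g = e.+1) (g_rho : root (map_poly phi g) (rho 0%N)).

Definition gm m : {poly F} := g \Po 'X^(p ^ m).

Lemma size_gm m : size (gm m) = (rdeg m).+1.
Proof.
have ng : gm m != 0.
  by rewrite comp_poly_eq0 ?size_polyXn ?ltnS ?expn_gt0 ?p_gt0 // -size_poly_gt0 size_g.
rewrite -(prednK (_ : 0 < size (gm m))%N) ?size_poly_gt0 //.
by rewrite size_comp_poly size_g size_polyXn.
Qed.

Lemma root_gm m x : x ^+ (p ^ m) = rho 0 -> (map_poly phi (gm m)).[x] = 0.
Proof.
move=> h; rewrite map_comp_poly map_polyXn horner_comp hornerXn h.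
exact/rootP.
Qed.

(** Reduce modulo [gm m], which kills rho_m and has degree [rdeg m]. *)
Lemma Kfield_expansion m y : Kfield m y -> exists f, y = expansion m f.
Proof.
case=> P ->; exists (fun n => (P %% gm m)`_n).
have ng : gm m != 0 by rewrite -size_poly_gt0 size_gm.
rewrite {1}(divp_eq P (gm m)) rmorphD rmorphM hornerD hornerM.
rewrite (root_gm (rho_exp0 m)) mulr0 add0r.
rewrite (@horner_coef_wide _ (rdeg m)).
  by apply: eq_bigr => i _; rewrite coef_map.
by rewrite size_map_poly -ltnS -size_gm ltn_modp.
Qed.

Lemma KfieldB m a b : Kfield m a -> Kfield m b -> Kfield m (a - b).
Proof. by case=> P -> [Q ->]; exists (P - Q); rewrite rmorphB hornerD hornerN. Qed.

Lemma KfieldM m a b : Kfield m a -> Kfield m b -> Kfield m (a * b).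
Proof. by case=> P -> [Q ->]; exists (P * Q); rewrite rmorphM hornerM. Qed.

Lemma Kfield_phi m a : Kfield m (phi a).
Proof. by exists a%:P; rewrite map_polyC hornerC. Qed.

Lemma Kfield_rho m : Kfield m (rho m).
Proof. by exists 'X; rewrite map_polyX hornerX. Qed.

Definition phi_range (a : L) : Prop := exists b, a = phi b.

Lemma subfield_phi_range : subfield_pred phi_range.
Proof.
split; first by exists 1; rewrite rmorph1.
- by move=> a b [x ->] [y ->]; exists (x - y); rewrite rmorphB.
- by move=> a b [x ->] [y ->]; exists (x * y); rewrite rmorphM.
by move=> a [x ->]; exists x^-1; rewrite fmorphV.
Qed.

Lemma algebraic_over (B : L -> Prop) : (forall a, B (phi a)) -> algebraic_pred B.
Proof.
move=> hB z; have [P nP /rootP Pz] := algF z; exists (map_poly phi P).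
by split=> //; [rewrite map_poly_eq0|move=> i; rewrite coef_map; exact: hB].
Qed.

Lemma Kfield_horner m P y : coefs_in phi_range P -> Kfield m y -> Kfield m P.[y].
Proof.
move=> hP [Q ->]; rewrite horner_coef.
elim/big_ind: _ => [||i _].
- by exists 0; rewrite rmorph0 horner0.
- by move=> _ _ [U ->] [V ->]; exists (U + V); rewrite rmorphD hornerD.
by case: (hP i) => a ->; exists (a%:P * Q ^+ i); rewrite rmorphM rmorphXn /= map_polyC hornerM hornerC horner_exp.
Qed.

Lemma subfield_Kfield m : subfield_pred (Kfield m).
Proof.
split; [by rewrite -(rmorph1 phi); exact: Kfield_phi|exact: KfieldB|exact: KfieldM|].
move=> a Ka; have [->|na] := eqVneq a 0.
  by rewrite invr0 -(rmorph0 phi); exact: Kfield_phi.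
have [|H [hH aH]] := algebraic_inverse subfield_phi_range _ na.
  by apply: algebraic_over => b; exists b.
have -> : a^-1 = H.[a] by apply: (mulfI na); rewrite aH divff.
exact: Kfield_horner.
Qed.

Lemma Kfield_mono m n y : (m <= n)%N -> Kfield m y -> Kfield n y.
Proof.
move=> le [P ->]; exists (P \Po 'X^(p ^ (n - m))).
by rewrite map_comp_poly map_polyXn horner_comp hornerXn -(rho_exp m (n - m)) subnK.
Qed.

Definition Kinf (y : L) : Prop := exists m, Kfield m y.

Lemma subfield_Kinf : subfield_pred Kinf.
Proof.
have join a b : Kinf a -> Kinf b -> exists m, Kfield m a /\ Kfield m b.
  move=> [m ha] [n hb]; exists (maxn m n).
  by split; [apply: Kfield_mono ha; exact: leq_maxl|apply: Kfield_mono hb; exact: leq_maxr].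
split.
- by exists 0%N; case: (subfield_Kfield 0).
- by move=> a b Ka Kb; have [m [ha hb]] := join a b Ka Kb; exists m; exact: KfieldB.
- by move=> a b Ka Kb; have [m [ha hb]] := join a b Ka Kb; exists m; exact: KfieldM.
by move=> a [m ha]; exists m; case: (subfield_Kfield m) => _ _ _; apply.
Qed.

Lemma algebraic_Kinf : algebraic_pred Kinf.
Proof. by apply: algebraic_over => a; exists 0%N; exact: Kfield_phi. Qed.

(** The coefficients of an integral expansion are integral, hence p-th powers
    modulo p, and rho_m is the p-th power of rho_(m+1). *)
Lemma frob_Kinf b : Kinf b -> vge v 0 b ->
  exists d, [/\ Kinf d, vge v 0 d & vge v 1 (b - d ^+ p)].
Proof.
case=> m /Kfield_expansion [f ->] hb.
have intf n : (n < rdeg m)%N -> vge v 0 (phi (f n)).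
  move=> lt; have [->|na] := eqVneq (f n) 0; first by rewrite rmorph0; exact: vge0.
  have nphi : phi (f n) != 0 by rewrite fmorph_eq0.
  have := vge_expansion hb lt => /(vgeE hv); rewrite term_neq0 => /(_ na).
  rewrite vrM ?expf_neq0 ?rho_neq0 // vrX ?rho_neq0 // vr_rho -(mulr_natl (_^-1)) => h.
  apply/(vgeE hv _ nphi); have [z ez] := vF na; move: h; rewrite ez => h.
  have lt1 : n%:R / (rdeg m)%:R < 1 :> R by rewrite ltr_pdivrMr // mul1r ltr_nat.
  have : (-1)%:~R < z%:~R :> R by rewrite rmorphN /=; lra.
  by rewrite ltr_int ler0z; lia.
have exh (n : nat) : exists b, (n < rdeg m)%N -> vge v 0 (phi b) /\ vge v 1 (phi (f n - b ^+ p)).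
  case: (ltnP n (rdeg m)) => [lt|_]; last by exists 0.
  by have [b' h1 h2] := frobF (intf n lt); exists b'.
have [h hE] := choice exh.
have rho_int n : vge v 0 (rho n).
  by apply/(vgeE hv); rewrite ?rho_neq0 // vr_rho invr_ge0 ler0n.
pose d := \sum_(n < rdeg m) phi (h n) * rho m.+1 ^+ n.
have ti (n : 'I_(rdeg m)) : vge v 0 (phi (h n) * rho m.+1 ^+ n).
  by apply: (vgeMl hv); [case: (hE n (ltn_ord n))|exact: vgeX0].
exists d; split.
- apply: (subfield_sum subfield_Kinf) => n _; exists m.+1; apply: KfieldM.
    exact: Kfield_phi.
  by apply: subfieldX; [exact: subfield_Kfield|exact: Kfield_rho].
- by apply: vge_sum.
apply: (vge_trans hv (y := \sum_(n < rdeg m) (phi (h n) * rho m.+1 ^+ n) ^+ p)).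
  rewrite /expansion -sumrB; apply: vge_sum => // n _.
  rewrite exprMn exprAC rhoS -mulrBl -rmorphXn -rmorphB.
  by apply: (vgeMr hv); [case: (hE n (ltn_ord n))|exact: vgeX0].
by apply: (vgeC hv); apply: vge_frob_sum.
Qed.

Lemma vr_rhoz m (z : int) : vr v (rho m ^ z) = z%:~R / (rdeg m)%:R.
Proof.
case: z => n; first by rewrite -exprnP vrX ?rho_neq0 // vr_rho -(mulr_natl (_^-1)).
rewrite NegzE -exprnN vrV ?expf_neq0 ?rho_neq0 // vrX ?rho_neq0 // vr_rho.
by rewrite rmorphN mulNr -(mulr_natl (_^-1)).
Qed.

Lemma dense_Kinf (B tau : R) : 0 < tau ->
  exists l, [/\ Kinf l, l != 0, B - tau <= vr v l & vr v l <= B].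
Proof.
move=> tau0; pose m := Num.bound tau^-1.
have hm : tau^-1 < (rdeg m)%:R.
  apply: (lt_le_trans (archi_boundP _)); first by rewrite invr_ge0 ltW.
  rewrite ler_nat -/m /rdeg; apply: leq_trans (leq_pmull _ e_gt0).
  by apply: ltnW; apply: ltn_expl; exact: prime_gt1.
have hE : (rdeg m)%:R^-1 < tau.
  by rewrite -[tau]invrK ltf_pV2 ?posrE ?invr_gt0.
have nE : (rdeg m)%:R != 0 :> R by rewrite lt0r_neq0.
move: hE nE; rewrite -/m; set E := (rdeg m)%:R => hE nE.
exists (rho m ^ (Num.floor (B * E))); split.
- exists m; case: (Num.floor _) => n.
    by apply: subfieldX; [exact: subfield_Kfield|exact: Kfield_rho].
  rewrite NegzE -exprnN; case: (subfield_Kfield m) => _ _ _; apply.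
  by apply: subfieldX; [exact: subfield_Kfield|exact: Kfield_rho].
- by rewrite expfz_neq0 // rho_neq0.
- rewrite vr_rhoz; have := floorD1_gt (B * E); rewrite -/E rmorphD /= => h.
  have : B - E^-1 <= (Num.floor (B * E))%:~R / E.
    by rewrite ler_pdivlMr ?rdegR // mulrBl mulVf //; lra.
  lra.
by rewrite vr_rhoz ler_pdivrMr ?rdegR // floor_le.
Qed.

Lemma Kinf_approximation z A eps : 0 < eps ->
  (forall s : {rmorphism L -> L}, bijective s -> (forall a, Kinf a -> s a = a) ->
     vge v A (s z - z)) ->
  exists2 y, Kinf y & vge v (A - eps) (z - y).
Proof.
move=> eps0 h; apply: (approximation hv p_pr vp subfield_Kinf algebraic_Kinf) => //.
  exact: frob_Kinf.
exact: dense_Kinf.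
Qed.

(** rho_N and zeta rho_N are roots of [gm N], which has the least possible degree
    by [expansion_eq0]. *)
Lemma kummer_automorphism N zeta : zeta ^+ (p ^ N) = 1 ->
  exists s : {rmorphism L -> L},
    [/\ bijective s, forall a, s (phi a) = phi a & s (rho N) = zeta * rho N].
Proof.
move=> zN; pose P := (lead_coef (map_poly phi (gm N)))^-1%:P * map_poly phi (gm N).
have ng : map_poly phi (gm N) != 0.
  by rewrite map_poly_eq0 -size_poly_gt0 size_gm.
have nl : lead_coef (map_poly phi (gm N)) != 0 by rewrite lead_coef_eq0.
have rootP x : x ^+ (p ^ N) = rho 0 -> P.[x] = 0.
  by move=> h; rewrite hornerM root_gm // mulr0.
have [|||||s [bs fs sN]] := conjugate_automorphism subfield_phi_range
  (algebraic_over (fun b => ex_intro _ b erefl)) (z := rho N) (z' := zeta * rho N) (P := P).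
- apply: coefs_in_mul; first exact: subfield_phi_range.
    apply: coefs_in_C; first exact: subfield_phi_range.
    by exists (lead_coef (gm N))^-1; rewrite fmorphV lead_coef_map.
  by move=> i; rewrite coef_map; exists (gm N)`_i.
- by rewrite monicE lead_coefM lead_coefC mulVf.
- exact/rootP/rho_exp0.
- by apply: rootP; rewrite exprMn zN mul1r rho_exp0.
- move=> P' hP' P'N; rewrite size_Cmul ?invr_eq0 // size_map_poly size_gm ltnS => sP'.
  have [f fE] := choice hP'.
  have : expansion N f = 0.
    rewrite -P'N (horner_coef_wide _ sP'); apply: eq_bigr => i _.
    by rewrite fE.
  move=> /expansion_eq0 f0; apply/polyP => k; rewrite coef0 fE.
  have [lt|le] := ltnP k (rdeg N); first by rewrite f0 // rmorph0.
  by rewrite -fE nth_default // (leq_trans sP').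
by exists s; split=> // a; apply: fs; exists a.
Qed.

(** Multiplied by (p - 1) e p^(N+1), the valuation of a term of index n becomes an
    integer congruent to (p - 1) n + e p^(l+1) modulo (p - 1) e p^(N+1), where l
    is the exponent of p in n.  If two of them agree, then their l agree by
    [twisted_logn_le], and so do their n. *)
Lemma twisted_distinct N (f : nat -> F) zeta (i k : 'I_(rdeg N.+1)) :
  zeta ^+ (p ^ N.+1) = 1 -> zeta ^+ (p ^ N) != 1 -> i != k ->
  phi (f i) * rho N.+1 ^+ i * (zeta ^+ i - 1) != 0 ->
  phi (f k) * rho N.+1 ^+ k * (zeta ^+ k - 1) != 0 ->
  vr v (phi (f i) * rho N.+1 ^+ i * (zeta ^+ i - 1))
  != vr v (phi (f k) * rho N.+1 ^+ k * (zeta ^+ k - 1)).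
Proof.
move=> e1 e2.
have aux (n : nat) : phi (f n) * rho N.+1 ^+ n * (zeta ^+ n - 1) != 0 ->
    [/\ (0 < n)%N, (logn p n <= N)%N & exists z : int,
    vr v (phi (f n) * rho N.+1 ^+ n * (zeta ^+ n - 1)) * (rdeg N.+1)%:R * (p%:R - 1) =
    ((p%:Z - 1) * (z * (rdeg N.+1)%:Z + n%:Z) + e%:Z * (p ^ (logn p n).+1)%N%:Z)%:~R].
  rewrite mulf_eq0 negb_or term_neq0 => /andP [na nz].
  have n0 : (0 < n)%N.
    by rewrite lt0n; apply: contraNneq nz => ->; rewrite expr0 subrr.
  have lN : (logn p n <= N)%N.
    rewrite leqNgt; apply/negP => lt; case/eqP: nz.
    have /dvdnP [c ->] : (p ^ N.+1 %| n)%N by rewrite pfactor_dvdn.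
    by rewrite mulnC exprM e1 expr1n subrr.
  split=> //; have [z ez] := vr_term N.+1 n na; exists z.
  have [nz' ev] := vr_prim_root_exp hv p_pr vp1 p_neq0 e1 e2 n0 lN.
  rewrite vrM ?term_neq0 // ez ev; set l := logn p n in lN *.
  have p1 : p%:R - 1 != 0 :> R by rewrite subr_eq0 pnatr_eq1 gtn_eqF // prime_gt1.
  have nE : (rdeg N.+1)%:R != 0 :> R by rewrite lt0r_neq0.
  have np : p%:R ^+ (N - l) != 0 :> R by rewrite expf_neq0 // lt0r_neq0.
  rewrite mulrDl divfK // invfM mulrDl -!mulrA [_ * (p%:R - 1)]mulrC.
  have -> : (rdeg N.+1)%:R = p%:R ^+ (N - l) * (e%:R * (p ^ l.+1)%:R) :> R.
    rewrite /rdeg -{1}(subnK lN) -addnS expnD !natrM natrX; ring.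
  rewrite !(intrD, intrM, mulrNz) -!pmulrn.
  by congr (_ + _); field; rewrite p1 np.
move=> ik ni nk; have [i0 li [z ez]] := aux _ ni; have [k0 lk [z' ez']] := aux _ nk.
apply: contra_neq ik => h; move: ez; rewrite h ez' => /eqP; rewrite eqr_int => /eqP eq.
have lik : (logn p i <= logn p k)%N by apply: (twisted_logn_le p_pr k0 i0 _ eq).
have lki : (logn p k <= logn p i)%N by apply: (twisted_logn_le p_pr i0 k0 _ (esym eq)).
have el : logn p i = logn p k by apply/eqP; rewrite eqn_leq lik.
apply: val_inj; apply: (@mod_expansion_inj (rdeg N.+1) i k z z') => //.
move: eq; rewrite el => /addIr /mulfI -> //.
by have := prime_gt1 p_pr; lia.
Qed.

(** Take for y' the terms of y whose index is divisible by q = p^(N+1-m).  For the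
    other indices n the order of zeta^n is at least p^(m+1), so zeta^n - 1 has at
    most the valuation 1/(p^m (p-1)), and by [twisted_distinct] the corresponding
    term of s y - y has valuation at least r. *)
Lemma descend N m y zeta (s : {rmorphism L -> L}) r : (m <= N)%N ->
  zeta ^+ (p ^ N.+1) = 1 -> zeta ^+ (p ^ N) != 1 ->
  (forall a, s (phi a) = phi a) -> s (rho N.+1) = zeta * rho N.+1 ->
  Kfield N.+1 y -> vge v r (s y - y) ->
  exists2 y', Kfield m y' & vge v (r - (p%:R ^+ m * (p%:R - 1))^-1) (y - y').
Proof.
move=> mN e1 e2 sphi srho /Kfield_expansion [f ->] h.
pose q := (p ^ (N.+1 - m))%N.
exists (\sum_(n < rdeg N.+1 | (q %| n)%N) phi (f n) * rho N.+1 ^+ n).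
  apply: (subfield_sum (subfield_Kfield m)) => n /dvdnP [c ->].
  apply: KfieldM; first exact: Kfield_phi.
  rewrite mulnC exprM -{1}(subnK (leqW mN)) rho_exp.
  by apply: subfieldX; [exact: subfield_Kfield|exact: Kfield_rho].
rewrite /expansion (bigID (fun n : 'I_(rdeg N.+1) => (q %| n)%N)) /= addrC addrK.
apply: vge_sum => // n nq.
have n0 : (0 < n)%N by rewrite lt0n; apply: contraNneq nq => ->; rewrite dvdn0.
have ln : (logn p n < N.+1 - m)%N by rewrite ltnNge -pfactor_dvdn.
have lN : (logn p n <= N)%N by lia.
have [nz ev] := vr_prim_root_exp hv p_pr vp1 p_neq0 e1 e2 n0 lN.
have ht : vge v r (phi (f n) * rho N.+1 ^+ n * (zeta ^+ n - 1)).
  have dist i k := @twisted_distinct N f zeta i k e1 e2.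
  apply: (vge_sum_distinct hv dist (r := r)).
  rewrite [X in vge v r X](_ : _ = s (expansion N.+1 f) - expansion N.+1 f) //.
  rewrite /expansion rmorph_sum -sumrB; apply: eq_bigr => k _.
  by rewrite rmorphM rmorphXn sphi srho exprMn; ring.
apply: vgeW (vgeMI hv nz (r := r - vr v (zeta ^+ n - 1)) _); last by rewrite subrK.
have p1 : 0 < p%:R - 1 :> R by rewrite subr_gt0 ltr1n prime_gt1.
rewrite lerD2l lerN2 ev lef_pV2 ?posrE ?mulr_gt0 ?exprn_gt0 // ler_pM2r //.
by rewrite ler_eXn2l ?ltr1n ?prime_gt1 //; lia.
Qed.

(** s multiplies rho_(m+1) by a root of unity of order dividing p^(m+1). *)
Lemma root_unity_action m y (s : {rmorphism L -> L}) r :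
  (forall a, s (phi a) = phi a) -> s (rho 0) = rho 0 ->
  Kfield m.+1 y -> vge v r y -> vge v (r + (p%:R ^+ m * (p%:R - 1))^-1) (s y - y).
Proof.
move=> sphi s0 /Kfield_expansion [f ->] hy.
pose zeta := s (rho m.+1) / rho m.+1.
have sE : s (rho m.+1) = zeta * rho m.+1 by rewrite divfK // rho_neq0.
have e1 : zeta ^+ (p ^ m.+1) = 1.
  by rewrite exprMn exprVn -rmorphXn rho_exp0 s0 divff.
rewrite /expansion rmorph_sum -sumrB; apply: vge_sum => // n _.
rewrite rmorphM rmorphXn sphi sE exprMn.
rewrite [X in vge v _ X](_ : _ = phi (f n) * rho m.+1 ^+ n * (zeta ^+ n - 1)); last by ring.
apply: (vgeM hv); first exact: vge_expansion.
apply: (vge_root_unity_sub1 hv p_pr vp1 p_neq0).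
by rewrite exprAC e1 expr1n.
Qed.

Lemma Kfield0_fixed y (s : {rmorphism L -> L}) :
  (forall a, s (phi a) = phi a) -> s (rho 0) = rho 0 -> Kfield 0 y -> s y = y.
Proof.
move=> sphi s0 [P ->]; rewrite -horner_map s0; congr (_.[_]).
by apply/polyP => k; rewrite !coef_map /= sphi.
Qed.

End Tower.

(** * Best approximation *)

Section Limits.
Variables (R : realType) (C : fieldType) (v : C -> \bar R).
Hypothesis hv : is_valuation v.

(** If v(x - y1) < v(x - y2), then v(x - y1) is the valuation of y2 - y1, which
    lies in (1/E) Z.  If no y in D reached B, then all values v(x - y) would be of
    this kind and accumulate at B. *)
Lemma best_approximation (D : C -> Prop) (E B : R) (x : C) : 0 < E ->
  (forall a b, D a -> D b -> D (a - b)) ->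
  (forall a, D a -> a != 0 -> exists z : int, vr v a = z%:~R / E) ->
  (forall eps, 0 < eps -> exists2 y, D y & vge v (B - eps) (x - y)) ->
  exists2 y, D y & vge v B (x - y).
Proof.
move=> E0 DB Dval approx; apply: contrapT => none.
have below y : D y -> x - y != 0 /\ vr v (x - y) < B.
  move=> Dy; have nz : x - y != 0.
    by apply/eqP => e; apply: none; exists y; rewrite // e; exact: vge0.
  split=> //; rewrite ltNge; apply/negP => le; apply: none; exists y => //.
  exact/(vgeE hv _ nz).
pose n := Num.ceil (B * E) - 1.
have nlt : n%:~R < B * E by have := ceilB1_lt (B * E); rewrite /n intrB.
have nge : B * E <= n%:~R + 1.
  by have := ceil_ge (B * E); rewrite /n intrB addrNK.
(* (1/E) Z has no element strictly between n/E and B. *)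
pose eta := B - n%:~R / E.
have eta0 : 0 < eta by rewrite subr_gt0 ltr_pdivrMr.
have [y1 D1 h1] := approx _ (divr_gt0 eta0 (ltr0n R 2)).
have [n1 l1] := below y1 D1.
have eps0 : 0 < (B - vr v (x - y1)) / 2 by rewrite divr_gt0 // subr_gt0.
have [y2 D2 h2] := approx _ eps0.
have lt12 : vr v (x - y1) < B - (B - vr v (x - y1)) / 2 by lra.
have := vr_gap hv n1 (vgeC hv h2) lt12.
have -> : x - y1 + (y2 - x) = y2 - y1 by ring.
case=> n21 e21; have [z ez] := Dval _ (DB _ _ D2 D1) n21.
rewrite e21 in ez; have /(vgeE hv _ n1) := h1; rewrite ez => h3.
rewrite ez in l1.
have zn : n%:~R < z%:~R :> R.
  have iE : 0 < E^-1 by rewrite invr_gt0.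
  by rewrite -(ltr_pM2r iE); apply: lt_le_trans h3; rewrite /eta in eta0 *; lra.
have zB : z%:~R < n%:~R + 1 :> R.
  by apply: lt_le_trans nge; rewrite -ltr_pdivrMr.
have : (z < n + 1)%R by rewrite -(ltr_int R) intrD.
by rewrite ltzD1 leNgt -(ltr_int R) zn.
Qed.

Lemma vge_limit (p : nat) (A : R) t : (1 < p)%N ->
  (forall m : nat, vge v (A - (p%:R ^+ m * (p%:R - 1))^-1) t) -> vge v A t.
Proof.
move=> p1 h; have [->|nt] := eqVneq t 0; first exact: vge0.
apply/(vgeE hv _ nt); rewrite leNgt; apply/negP => lt.
have d0 : 0 < A - vr v t by rewrite subr_gt0.
pose m := Num.bound (A - vr v t)^-1.
have pR : 1 <= p%:R - 1 :> R.
  have : (2 : R) <= p%:R by rewrite ler_nat.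
  lra.
have hm : (A - vr v t)^-1 < p%:R ^+ m * (p%:R - 1).
  apply: (lt_le_trans (archi_boundP _)); first by rewrite invr_ge0 ltW.
  rewrite -/m; apply: (@le_trans _ _ (p%:R ^+ m)).
    by rewrite -natrX ler_nat ltnW // ltn_expl.
  by rewrite ler_peMr // exprn_ge0 // ler0n.
have c0 : 0 < p%:R ^+ m * (p%:R - 1) :> R.
  by apply: lt_trans hm; rewrite invr_gt0.
have /(vgeE hv _ nt) := h m.
have : (p%:R ^+ m * (p%:R - 1))^-1 < A - vr v t.
  by rewrite -[X in _ < X]invrK ltf_pV2 // ?posrE ?invr_gt0.
lra.
Qed.

End Limits.

(** * Continuous extension of isometries to the completion *)
Section Completion.
Variables (R : realType) (L C : fieldType) (v : C -> \bar R).
Variables (j : {rmorphism L -> C}) (g : {rmorphism L -> L}).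
Hypothesis hC : is_completion v j.
Hypothesis iso : forall z, v (j (g z)) = v (j z).

Let hv : is_valuation v. Proof. by case: hC. Qed.

Lemma isometry_sub B z z' : vge v B (j z - j z') -> vge v B (j (g z) - j (g z')).
Proof. by rewrite -!rmorphB /vge iso. Qed.

(** The image s x is close to s (j z') for z' close enough to x, by continuity,
    and s (j z') = j (g z') is close to j (g z). *)
Lemma extension_isometry (s : C -> C) : extends_by_continuity v j g s ->
  forall x z B, vge v B (x - j z) -> vge v B (s x - j (g z)).
Proof.
case=> cont ext x z B h; have [D hD] := cont x B.
case: (hC) => _ _ /(_ x (Num.max D B)) [z' hz'].
have hB : vge v B (x - j z') by apply: vgeW hz'; rewrite le_max lexx orbT.
apply: (vge_trans hv (y := j (g z'))).
  rewrite -ext; apply: (vgeC hv); apply: hD.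
  by apply: (vgeC hv (r := D)); apply: vgeW hz'; rewrite le_max lexx.
by apply: isometry_sub; apply: vge_trans h => //; apply: vgeC.
Qed.

(** Map x to the limit of j (g z_n) for a sequence z_n in L that tends to x. *)
Lemma extension_exists : exists s, extends_by_continuity v j g s.
Proof.
have close x : exists l, forall z B, vge v B (x - j z) -> vge v B (l - j (g z)).
  case: (hC) => _ compl dense.
  have [Z hZ] := choice (fun n : nat => dense x n%:R).
  have large (B : R) : exists n : nat, B <= n%:R.
    exists (Num.bound `|B|).
    by apply: le_trans (ler_norm B) (ltW (archi_boundP (normr_ge0 _))).
  have [|l hl] := compl (fun n => j (g (Z n))).
    move=> B; have [N hN] := large B; exists N => m n hm hn.
    apply: isometry_sub; apply: (vge_trans hv (y := x)); first apply: (vgeC hv).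
      by apply: vgeW (hZ m); apply: le_trans hN _; rewrite ler_nat.
    by apply: vgeW (hZ n); apply: le_trans hN _; rewrite ler_nat.
  exists l => z B h; have [N hN] := large B; have [N' hN'] := hl B.
  pose n := maxn N N'; apply: (vge_trans hv (y := j (g (Z n)))).
    by apply: (vgeC hv); apply: hN'; exact: leq_maxr.
  apply: isometry_sub; apply: vge_trans h => //; apply: (vgeC hv).
  by apply: vgeW (hZ n); apply: le_trans hN _; rewrite ler_nat leq_maxl.
have [s hs] := choice close; exists s; split.
  move=> x B; exists B => y h; case: (hC) => _ _ /(_ x B) [z hz].
  apply: (vge_trans hv (y := j (g z))).
    by apply: hs; apply: vge_trans hz.
  by apply: (vgeC hv); apply: hs.
move=> z; apply/eqP; rewrite -subr_eq0; apply/eqP/(vge_eq0 hv) => n.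
by apply: hs; rewrite subrr; exact: vge0.
Qed.

End Completion.

(** * The tower over K *)

Lemma algebraic_over_base (F : fieldType) (K : fieldExtType F) (L : fieldType)
    (i : {rmorphism K -> L}) z :
  algebraicOver i z -> algebraicOver (i \o in_alg K) z.
Proof.
move=> /integral_algebraic [P mP rP]; apply/integral_algebraic.
apply: (integral_root_monic (p := map_poly i P)); rewrite ?monic_map //.
apply/integral_poly => n; rewrite coef_map; apply/integral_algebraic.
have /polyOver1P [q qE] := minPolyOver 1%AS P`_n.
exists q.
  by rewrite -(map_poly_eq0 (in_alg K)) -qE monic_neq0 // monic_minPoly.
by rewrite map_poly_comp -qE; apply/rmorph_root/root_minPoly.
Qed.

Lemma is_valuation_comp (R : realType) (L C : fieldType) (f : {rmorphism L -> C})
    (v : C -> \bar R) : is_valuation v -> is_valuation (v \o f).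
Proof.
case=> vN v0 vM vD; split=> /=.
- by move=> x; exact: vN.
- move=> x; rewrite v0; split=> [/eqP|->]; last exact: rmorph0.
  by rewrite fmorph_eq0 => /eqP.
- by move=> x y; rewrite rmorphM vM.
by move=> x y; rewrite rmorphD.
Qed.

Section Assembly.
Variables (R : realType) (p : nat) (k : fieldType) (hk : perfect_char p k).
Variables (W : idomainType) (c : W -> nat -> k) (hW : is_Witt_ring p c).
Variables (K : fieldExtType {fraction W}) (Kbar : closedFieldType).
Variables (i : {rmorphism K -> Kbar}) (hKbar : is_algebraic_closure i).
Variables (w : Kbar -> \bar R) (hw : is_valuation w).
Let phi : {rmorphism {fraction W} -> Kbar} := i \o in_alg K.
Hypothesis hpad : is_padic_valuation p (w \o phi).
Hypothesis hK : totally_ramified (w \o i).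
Variables (pi : K) (hpi : is_uniformizer (w \o i) pi).
Variables (rho : nat -> Kbar) (hrho0 : rho 0%N = i pi).
Hypothesis hrhoS : forall m, rho m.+1 ^+ p = rho m.

Let e := \dim {:K}.
Let p_pr : prime p := perfect_prime hk.

Lemma vr_phi a : vr w (phi a) = vr (w \o phi) a. Proof. by []. Qed.

Lemma base_p : vr w p%:R = 1.
Proof. by rewrite -(padic_p hk hW hpad) -vr_phi rmorph_nat. Qed.

Lemma base_p_neq0 : (p%:R : Kbar) != 0.
Proof. by rewrite -(rmorph_nat phi) fmorph_eq0 (padic_p_neq0 hk hW hpad). Qed.

Lemma base_int a : a != 0 -> exists z : int, vr w (phi a) = z%:~R.
Proof. by move=> /(padic_int hk hW hpad). Qed.

Lemma base_frob a : vge w 0 (phi a) ->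
  exists2 b, vge w 0 (phi b) & vge w 1 (phi (a - b ^+ p)).
Proof. by move=> h; have [b h1 h2] := padic_frob hk hW hpad h; exists b. Qed.

Lemma base_complete : complete_for phi w.
Proof. by move=> u cu; exact: (padic_complete hk hW hpad). Qed.

Lemma base_algebraic z : algebraicOver phi z.
Proof. exact/algebraic_over_base/hKbar. Qed.

Lemma e_gt0 : (0 < e)%N. Proof. exact: adim_gt0. Qed.

Lemma rho0_neq0 : rho 0%N != 0.
Proof. by rewrite hrho0 fmorph_eq0; case: hpi. Qed.

(** A uniformizer of F has the valuation 1 of p, which is e times that of pi. *)
Lemma vr_rho0 : vr w (rho 0%N) = e%:R^-1.
Proof.
have gt0E a : (0 < w a)%E -> a != 0 -> 0 < vr w a.
  by move=> h na; move: h; rewrite (v_vr hw na) lte_fin.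
case: hK => tF [tK [[tF0 ntF minF] [tK0 ntK minK] eF]].
case: hpi => pi0 npi minpi.
have npi' : i pi != 0 by rewrite fmorph_eq0.
have ntK' : i tK != 0 by rewrite fmorph_eq0.
have ntF' : phi tF != 0 by rewrite fmorph_eq0.
have vtF : vr w (phi tF) = 1.
  apply/eqP; rewrite eq_le; apply/andP; split.
    have := minF p%:R; rewrite /= -[i _]/(phi _) -[i _ in X in _ -> X]/(phi _).
    rewrite rmorph_nat (v_vr hw base_p_neq0) (v_vr hw ntF') base_p lte_fin lee_fin.
    by apply; exact: ltr01.
  have [z ez] := base_int ntF; have := gt0E _ tF0 ntF'.
  rewrite ez ltr0z => z0; have : (1 : int)%:~R <= z%:~R :> R by rewrite ler_int -gtz0_ge1.
  by rewrite mulr1z.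
have vpi : vr w (i pi) = vr w (i tK).
  have h1 := minK _ pi0; have h2 := minpi _ tK0.
  move: h1 h2; rewrite /= (v_vr hw npi') (v_vr hw ntK') !lee_fin => h1 h2.
  by apply/eqP; rewrite eq_le h1 h2.
move: eF; rewrite /= -[i _]/(phi _) (v_vr hw ntF') (v_vr hw ntK') vtF -EFinM => -[h].
have ne : e%:R != 0 :> R by rewrite pnatr_eq0 -lt0n e_gt0.
by rewrite hrho0 vpi; apply: (mulfI ne); rewrite -h divff.
Qed.

Lemma base_tower : kummer_tower phi w p e rho.
Proof.
split=> //; [exact: base_p|exact: base_p_neq0|exact: base_int|exact: base_frob| | | |].
- exact: base_algebraic.
- exact: e_gt0.
- exact: rho0_neq0.
- exact: vr_rho0.
Qed.

(** The powers of pi of exponent less than e = [K : F] have valuations that are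
    different modulo 1, so they are linearly independent, and K = F(pi). *)
Lemma base_generator : exists g : {poly {fraction W}},
  [/\ size g = e.+1, root (map_poly phi g) (rho 0%N)
    & forall a : K, exists P, a = (map_poly (in_alg K) P).[pi]].
Proof.
have /polyOver1P [g gE] := minPolyOver 1%AS pi.
have sg : size g = (adjoin_degree 1%AS pi).+1.
  by rewrite -(size_minPoly 1%AS) gE size_map_poly.
have rg : root (map_poly phi g) (rho 0%N).
  by rewrite hrho0 map_poly_comp -gE; apply/rmorph_root/root_minPoly.
have degE : adjoin_degree 1%AS pi = \dim <<1; pi>>%VS.
  by rewrite dim_Fadjoin dimv1 muln1.
have le1 : (adjoin_degree 1%AS pi <= e)%N by rewrite degE dimvS ?subvf.
have le2 : (e <= adjoin_degree 1%AS pi)%N.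
  rewrite leqNgt; apply/negP => lt.
  have sge : (size g <= rdeg p e 0)%N by rewrite sg /rdeg expn0 muln1.
  have g0 : g = 0.
    apply/polyP => n; rewrite coef0.
    have [ln|ln] := ltnP n (rdeg p e 0); last by rewrite nth_default // (leq_trans sge).
    apply: (expansion_eq0 base_tower (f := fun n => g`_n)) ln.
    rewrite -[RHS](rootP rg) (@horner_coef_wide _ (rdeg p e 0)) ?size_map_poly //.
    by apply: eq_bigr => n' _; rewrite coef_map.
  by move: sg; rewrite g0 size_poly0.
have dE : adjoin_degree 1%AS pi = e by apply/eqP; rewrite eqn_leq le1 le2.
exists g; rewrite sg dE; split=> // a; apply/Fadjoin1_polyP.
suff -> : <<1; pi>>%VS = fullv by exact: memvf.
by apply/eqP; rewrite eqEdim subvf -degE dE leqnn.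
Qed.

Lemma adjoin_Kfield m y : in_adjoin i (rho m) y <-> Kfield phi rho m y.
Proof.
have [g [sg rg gen]] := base_generator.
have sK := subfield_Kfield base_tower m.
have Ki a : Kfield phi rho m (i a).
  have [P ->] := gen a; rewrite -horner_map -map_poly_comp -hrho0.
  rewrite -(rho_exp0 base_tower m) /=.
  apply: Kfield_horner; first by move=> n; rewrite coef_map; exists P`_n.
  by apply: subfieldX => //; exact: Kfield_rho.
have KP (P : {poly K}) : Kfield phi rho m (map_poly i P).[rho m].
  rewrite horner_coef; apply: (subfield_sum sK) => n _; rewrite coef_map.
  by apply: KfieldM; [exact: Ki|apply: (subfieldX sK); exact: Kfield_rho].
split=> [[P [Q [_ ->]]]|[P ->]].
  by apply: KfieldM; [exact: KP|case: sK => _ _ _ KV; apply: KV; exact: KP].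
exists (map_poly (in_alg K) P), 1; rewrite rmorph1 hornerC oner_eq0 invr1 mulr1.
by rewrite -map_poly_comp.
Qed.

(** K is generated over F by pi. *)
Lemma fix_base (s : {rmorphism Kbar -> Kbar}) :
  (forall a, s (phi a) = phi a) -> s (rho 0%N) = rho 0%N -> forall a, s (i a) = i a.
Proof.
move=> sphi s0 a; have [g [_ _ gen]] := base_generator.
apply: (Kfield0_fixed sphi s0); have [P ->] := gen a.
by exists P; rewrite hrho0 -horner_map -map_poly_comp.
Qed.

Lemma galois_isometry (s : {rmorphism Kbar -> Kbar}) :
  (forall a, s (phi a) = phi a) -> forall z, w (s z) = w z.
Proof.
move=> sphi z; apply/esym.
apply: (unique_extension hw (is_valuation_comp s hw) base_complete _ (base_algebraic z)).
by move=> a /=; rewrite sphi.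
Qed.

End Assembly.

Theorem mainTheorem1
  (R : realType) (p : nat) (k : fieldType)
  (hk : perfect_char p k)
  (* W = W(k), with Witt coordinates c; F = Frac W *)
  (W : idomainType) (c : W -> nat -> k) (hW : is_Witt_ring p c)
  (K : fieldExtType {fraction W})
  (Kbar : closedFieldType) (i : {rmorphism K -> Kbar})
  (hKbar : is_algebraic_closure i)
  (C : fieldType) (j : {rmorphism Kbar -> C}) (v : C -> \bar R)
  (hC : is_completion v j)
  (hv : is_padic_valuation p
          (fun a : {fraction W} => v (j (i (in_alg K a)))))
  (hK : totally_ramified (fun a : K => v (j (i a))))
  (pi : K) (hpi : is_uniformizer (fun a : K => v (j (i a))) pi)
  (pi_ : nat -> Kbar)
  (hpi0 : pi_ 0%N = i pi)
  (hpiS : forall m : nat, pi_ m.+1 ^+ p = pi_ m)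
  (x : C) (A : R) :
  (forall (g : {rmorphism Kbar -> Kbar}) (s : C -> C),
     in_Gal i g -> extends_by_continuity v j g s ->
     (A%:E <= v (s x - x)%R)%E)
  <->
  (forall m : nat, exists y : Kbar,
     in_adjoin i (pi_ m) y /\
     ((A - (p%:R ^+ m * (p%:R - 1))^-1)%:E <= v (x - j y)%R)%E).
Proof.
have p_pr := perfect_prime hk.
have vC : is_valuation v by case: hC.
pose w := v \o j; have hw : is_valuation w by apply: is_valuation_comp.
pose phi : {rmorphism {fraction W} -> Kbar} := i \o in_alg K.
pose T : kummer_tower phi w p (\dim {:K}) pi_ :=
  base_tower hk hW hKbar hw hv hK hpi hpi0 hpiS.
have [g [sg rg _]] := base_generator hk hW hKbar hw hv hK hpi hpi0 hpiS.
have adjE := adjoin_Kfield hk hW hKbar hw hv hK hpi hpi0 hpiS.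
have fixK := fix_base hk hW hKbar hw hv hK hpi hpi0 hpiS.
have iso := galois_isometry hk hW hKbar hw (w := w) hv.
(* The valuation of zeta - 1 for zeta of order p^(m+1). *)
pose cm m : R := (p%:R ^+ m * (p%:R - 1))^-1.
have p1 : 0 < p%:R - 1 :> R by rewrite subr_gt0 ltr1n prime_gt1.
have cm0 m : 0 < cm m.
  by rewrite invr_gt0 mulr_gt0 // exprn_gt0 // ltr0n prime_gt0.
have vgeJ B a b : vge w B (a - b) <-> vge v B (j a - j b).
  by rewrite -rmorphB.
split=> [H m|H s t [bs fixs] ext].
  (* The hypothesis on x passes to elements of Kbar close to x. *)
  have conj (s : {rmorphism Kbar -> Kbar}) z : vge v A (x - j z) -> bijective s ->
      (forall a, s (i a) = i a) -> vge w A (s z - z).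
    move=> hz bs fs; apply/vgeJ.
    have isos := iso s (fun a => fs _); have [t ext] := extension_exists hC isos.
    have hx : vge v A (t x - x) by apply: H ext.
    have ht := extension_isometry hC isos ext hz.
    by apply: (vge_trans vC (vgeC vC ht)); apply: (vge_trans vC hx).
  have [|||eps eps0|_ [y Ky <-] hy] := best_approximation vC
    (D := fun b => exists2 y, Kfield phi pi_ m y & j y = b)
    (E := (rdeg p (\dim {:K}) m)%:R) (B := A - cm m) (x := x).
  - by rewrite ltr0n (rdeg_gt0 T).
  - move=> _ _ [a Ka <-] [b Kb <-]; exists (a - b); last exact: rmorphB.
    exact: KfieldB.
  - move=> _ [a Ka <-] nz.
    have [f ef] := Kfield_expansion T sg rg Ka.
    have := vr_expansion T (m := m) (f := f).
    by rewrite -ef; apply; rewrite -(fmorph_eq0 j).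
  - case: (hC) => _ _ /(_ x A) [z hz].
    have [|y [N0 Ky] hzy] := Kinf_approximation T sg rg (z := z) (A := A) eps0.
      move=> s bs fs; apply: conj => //; apply: fixK.
        by move=> a; apply: fs; exists 0%N; exact: Kfield_phi.
      by apply: fs; exists 0%N; exact: Kfield_rho.
    (* The automorphism is chosen for the level N + 1, which is larger than m. *)
    pose N := maxn N0 m.
    have KyN : Kfield phi pi_ N.+1 y.
      by apply: (Kfield_mono T) Ky; rewrite leqW // leq_maxl.
    have [zeta [z1 z2]] := prim_root_exists p_pr (tower_p_neq0 T) N.
    have [s [bs sphi srho]] := kummer_automorphism T sg rg z1.
    have s0 : s (pi_ 0%N) = pi_ 0%N.
      by rewrite -(rho_exp0 T N.+1) rmorphXn srho exprMn z1 mul1r.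
    have hsz := conj s z hz bs (fixK s sphi s0).
    have hsy : vge w (A - eps) (s y - y).
      have h : vge w (A - eps) (s y - s z).
        by rewrite -rmorphB /vge iso //; apply: (vgeC hw).
      apply: (vge_trans hw h); apply: (vge_trans hw _ hzy).
      by apply: (vgeW _ hsz); rewrite gerBl ltW.
    have [y' Ky' hy'] := descend T sg rg (leq_maxr N0 m) z1 z2 sphi srho KyN hsy.
    exists (j y'); first by exists y'.
    have c0 := cm0 m.
    apply: (vge_trans vC (y := j z)); first by apply: (vgeW _ hz); lra.
    apply/vgeJ; apply: (vge_trans hw (y := y)).
      by apply: (vgeW _ hzy); lra.
    by apply: (vgeW _ hy'); rewrite /cm; lra.
  by exists y; split=> //; apply/adjE.
have isos := iso s (fun a => fixs _).
have sphi a : s (phi a) = phi a by apply: fixs.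
have s0 : s (pi_ 0%N) = pi_ 0%N by rewrite hpi0 fixs.
have [y hy] := choice H.
have Ky m : Kfield phi pi_ m (y m) by apply/adjE; case: (hy m).
have vy m : vge v (A - cm m) (x - j (y m)) by case: (hy m).
have sy m : vge w A (s (y m) - y m).
  elim: m => [|m IH].
    by rewrite (Kfield0_fixed sphi s0 (Ky 0%N)) subrr; exact: vge0.
  have Kd : Kfield phi pi_ m.+1 (y m.+1 - y m).
    by apply: KfieldB => //; apply: (Kfield_mono T) (Ky m).
  have hd : vge w (A - cm m) (y m.+1 - y m).
    apply/vgeJ; apply: (vge_trans vC (y := x)) (vy m); apply: (vgeC vC).
    apply: vgeW (vy m.+1); rewrite lerD2l lerN2 /cm exprS -mulrA.
    rewrite lef_pV2 ?posrE ?mulr_gt0 ?exprn_gt0 ?ltr0n ?prime_gt0 //.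
    rewrite ler_peMl ?ler1n ?prime_gt0 // ltW // mulr_gt0 // exprn_gt0 // ltr0n.
    exact: prime_gt0.
  have := root_unity_action T sg rg sphi s0 Kd hd.
  rewrite subrK rmorphB => h.
  have -> : s (y m.+1) - y m.+1 = (s (y m.+1) - s (y m) - (y m.+1 - y m)) + (s (y m) - y m) by ring.
  exact: vgeD.
apply: (vge_limit vC (prime_gt1 p_pr)) => m.
apply: (vge_trans vC (extension_isometry hC isos ext (vy m))).
apply: (vge_trans vC (y := j (y m))); last exact: (vgeC vC (vy m)).
by apply/vgeJ; apply: vgeW (sy m); rewrite gerBl ltW.
Qed.
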